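(* For $0<\rho<1$, let $W_\rho(\infty)$ be the steady-state workload of the $S/D/1$ queue with service capacity $1/\rho$ fed by a scheduled arrival process with i.i.d. perturbations $(\xi_j)_{j\in\mathbb{Z}}$ (defined in the context). Suppose that $\mathbb{E}\xi_0^-<\infty$, where $\xi_0^-=\max(-\xi_0,0)$, and that there exist constants $c>0$ and $\alpha>1$ for which $\mathbb{P}(\xi_0>x)\sim c\,x^{-\alpha}$ as $x\to\infty$. Then $$\frac{\log\log\left(\frac{1}{1-\rho}\right)}{\log\left(\frac{1}{1-\rho}\right)}\,W_\rho(\infty)\Rightarrow\frac1\alpha$$ as $\rho\nearrow1$, where $\Rightarrow$ denotes convergence in distribution.
   Context: $(\xi_j:j\in\mathbb{Z})$ is an i.i.d. sequence of real-valued random variables and $U$ is uniform on $[0,1]$, independent of $(\xi_j)$. Customer $j\in\mathbb{Z}$ is scheduled at time $j+U$ and arrives at time $j+\xi_j+U$. $I(\cdot)$ is an indicator and all sums are over integers $i$ or $j$. $N(t)=\sum_{j}I(j+\xi_j+U\in(0,t])$ for $t\ge0$; for $t\in\mathbb{R}$, $\mathcal{E}(t)=\sum_{i+U>t}I(i+\xi_i+U\le t)$ (early customers) and $\mathcal{L}(t)=\sum_{i+U\le t}I(i+\xi_i+U>t)$ (late customers). Put $a(t)=-(t-\lfloor t\rfloor)+I(U\le t-\lfloor t\rfloor)$. Each customer brings a unit amount of work and the server works at rate $1/\rho$, $0<\rho<1$. The workload process, started from $W_\rho(0)=0$, is $$W_\rho(t)=\max_{0\le s\le t}\Big[\mathcal{E}(t)-\mathcal{E}(s)-\mathcal{L}(t)+\mathcal{L}(s)+a(t)-a(s)-\tfrac{1-\rho}{\rho}(t-s)\Big],$$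 the maximum being understood as a supremum; equivalently $W_\rho(t)=\sup_{0\le s\le t}\big[N(t)-N(s)-(t-s)/\rho\big]$ a.s. $W_\rho(\infty)$ denotes a random variable having the limiting distribution of $W_\rho(t)$ as $t\to\infty$, i.e. $W_\rho(t)\Rightarrow W_\rho(\infty)$ as $t\to\infty$ (this limit exists, since by stationarity $W_\rho(t)$ is equal in distribution to a process that is nondecreasing in $t$). $g(x)\sim h(x)$ means $g(x)/h(x)\to1$. *)

(* Defs.v *)
From HB Require Import structures.
From mathcomp Require Export all_boot all_order all_algebra.
From mathcomp Require Export all_classical all_reals all_analysis.

Set Implicit Arguments.
Unset Strict Implicit.
Unset Printing Implicit Defensive.

Import Order.TTheory GRing.Theory Num.Theory.
Export numFieldNormedType.Exports.

Local Open Scope classical_set_scope.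
Local Open Scope ring_scope.

(* Weak convergence along a filter F. The X i may live on different
   probability spaces. *)
Definition cvg_in_distribution (R : realType) (I : Type) (F : set_system I)
    (d : I -> measure_display) (T : forall i, measurableType (d i))
    (P : forall i, probability (T i) R) (X : forall i, T i -> R)
    (d' : measure_display) (T' : measurableType d') (Q : probability T' R)
    (Y : T' -> R) : Prop :=
  forall f : R -> R, continuous f -> bounded_fun f ->
    'E_(P i)[f \o X i]%E @[i --> F] --> 'E_Q[f \o Y]%E.

Section probabilistic_assumptions.
Context (R : realType) (d : measure_display) (T : measurableType d)
  (P : probability T R).

Definition mutually_independent (I : choiceType) (X : I -> {RV P >-> R}) : Prop :=
  forall (s : seq I) (A : I -> set R), uniq s -> (forall i, measurable (A i)) ->
    P (\bigcap_(i in [set` s]) X i @^-1` A i) =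
    (\prod_(i <- s) P (X i @^-1` A i))%E.

Definition identically_distributed (I : Type) (X : I -> {RV P >-> R}) : Prop :=
  forall (i j : I) (A : set R), measurable A ->
    distribution P (X i) A = distribution P (X j) A.

Definition sigma_of_family (I : Type) (X : I -> {RV P >-> R}) : set (set T) :=
  <<s [set E | exists i (A : set R), measurable A /\ E = X i @^-1` A] >>.

Definition independent_of_family (I : Type) (Y : {RV P >-> R})
    (X : I -> {RV P >-> R}) : Prop :=
  forall (B : set R) (E : set T), measurable B -> sigma_of_family X E ->
    P (Y @^-1` B `&` E) = (P (Y @^-1` B) * P E)%E.

Definition uniform01 (Y : {RV P >-> R}) : Prop :=
  forall A : set R, measurable A ->
    distribution P Y A = uniform_prob (@ltr01 R) A.

End probabilistic_assumptions.

Section workload.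
Context (R : realType) (T : Type) (xi : int -> T -> R) (U : T -> R).

(* The two counts are extended reals because on a null set
   infinitely many customers may be early or late. *)
Definition early (t : R) (w : T) : \bar R :=
  \esum_(i in [set i : int | t < i%:~R + U w])
    (i%:~R + xi i w + U w <= t)%R%:R%:E.

Definition late (t : R) (w : T) : \bar R :=
  \esum_(i in [set i : int | i%:~R + U w <= t])
    (t < i%:~R + xi i w + U w)%R%:R%:E.

Definition sched_offset (t : R) (w : T) : R :=
  - (t - (Num.floor t)%:~R) + (U w <= t - (Num.floor t)%:~R)%R%:R.

(* When E[xi_0^-] and E[xi_0^+] are finite, the supremum is almost surely finite;
   [fine] only affects the exceptional null set. *)
Definition workload (rho t : R) (w : T) : R :=
  fine (ereal_sup
    [set (early t w - early s w - late t w + late s w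
          + (sched_offset t w)%:E - (sched_offset s w)%:E
          - ((1 - rho) / rho * (t - s))%:E)%E | s in `[0, t]]).

End workload.

(* Main.v *)
(* Let [K = ln (1 / (1 - rho))]. The net input over [(s, t]] is
   [early t - early s - late t + late s] up to a bounded term and the drift
   [- (1 - rho) / rho * (t - s)]. The values at time [t] stay bounded in
   probability and [early s] enters negatively, so the workload is governed by
   the largest value of [late] among the last [exp K] unit time intervals.
   [late s] is dominated by, and essentially is, a sum of independent indicators
   of probabilities of order [j ^ - alpha], so it exceeds [n] with probability
   [exp (- (alpha + o(1)) n ln n)], and the largest of [exp K] such variables is
   [(1 / alpha + o(1)) K / ln K].
   Upper bound: Chernoff's bound with parameter [a * ln K], where [a < alpha] is
   close to [alpha] and [1 + u <= exp (u ^ b / b)] with [1 / alpha < b < 1 / a],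
   so that the Laplace transform contributes [exp (O(K ^ (a b))) = exp (o(K))];
   then a union bound over integer times, summable thanks to the drift.
   Lower bound: [late] is at least [n] at time [k] when customers
   [k - 1, ..., k - n] have delays above [1, ..., n]; these events for disjoint
   blocks of customers are independent, have probability
   [exp (- alpha n ln n + O(n))] and are independent of [early k], and a second
   moment argument produces a block where [early k] is small as well. *)
Require Import Defs.
From mathcomp Require Import measurable_realfun ring lra zify.

Import Order.TTheory GRing.Theory Num.Theory.
Local Open Scope classical_set_scope.
Local Open Scope ring_scope.
Set Implicit Arguments.
Unset Strict Implicit.
Unset Printing Implicit Defensive.

(** * Probabilities of sums of indicators *)

Section sums_of_indicators.
Context (R : realType) (d : measure_display) (T : measurableType d)
  (P : probability T R).
Implicit Types A B : set T.

(** A real value lets the estimates below be left to real arithmetic; nothing is lost on measurable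
    sets, where [P] is finite. *)
Definition pr A : R := fine (P A).

Lemma prE A : measurable A -> P A = (pr A)%:E.
Proof. by move=> mA; rewrite fineK// fin_num_measure. Qed.

Lemma pr_ge0 A : 0 <= pr A.
Proof. exact/fine_ge0/measure_ge0. Qed.

Lemma prT : pr setT = 1.
Proof. by rewrite /pr probability_setT. Qed.

Lemma pr_le1 A : measurable A -> pr A <= 1.
Proof. by move=> mA; rewrite -lee_fin -prE// probability_le1. Qed.

Lemma le_pr A B : measurable A -> measurable B -> A `<=` B -> pr A <= pr B.
Proof.
by move=> mA mB AB; rewrite -lee_fin -!prE// le_measure// inE.
Qed.

(** Integrability and the value of the integral travel together, so that linearity and monotonicity
    of expectations need no side conditions. *)
Definition has_mean (f : T -> R) (v : R) : Prop :=
  P.-integrable setT (EFin \o f) /\ (\int[P]_w (f w)%:E = v%:E)%E.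

Lemma has_mean_indic A : measurable A -> has_mean \1_A (pr A).
Proof.
move=> mA; split; first exact: integrable_indic.
by rewrite integral_indic// setIT -prE.
Qed.

Lemma has_meanD f g u v :
  has_mean f u -> has_mean g v -> has_mean (fun w => f w + g w) (u + v).
Proof.
move=> [intf fE] [intg gE]; split.
  have -> : EFin \o (fun w => f w + g w) =
      (fun w => (EFin \o f) w + (EFin \o g) w)%E by [].
  exact: integrableD.
under eq_integral do rewrite EFinD.
by rewrite integralD// fE gE.
Qed.

Lemma has_meanZ c f v : has_mean f v -> has_mean (fun w => c * f w) (c * v).
Proof.
move=> [intf fE]; split.
  have -> : EFin \o (fun w => c * f w) = (fun w => c%:E * (EFin \o f) w)%E by [].
  exact: integrableZl.
under eq_integral do rewrite EFinM.
by rewrite integralZl// fE.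
Qed.

Lemma has_mean_cst c : has_mean (fun=> c) c.
Proof.
rewrite -[X in has_mean _ X]mulr1 -prT.
have -> : (fun=> c) = (fun w => c * \1_[set: T] w).
  by apply/funext => w; rewrite indicT mulr1.
exact/has_meanZ/has_mean_indic.
Qed.

Lemma has_mean_sum (I : Type) (r : seq I) (f : I -> T -> R) (v : I -> R) :
    (forall i, has_mean (f i) (v i)) ->
  has_mean (fun w => \sum_(i <- r) f i w) (\sum_(i <- r) v i).
Proof.
move=> fv; elim: r => [|i r IH].
  rewrite big_nil (_ : (fun _ => _) = (fun=> 0)); first exact: has_mean_cst.
  by apply/funext => w; rewrite big_nil.
rewrite big_cons (_ : (fun _ => _) = (fun w => f i w + \sum_(j <- r) f j w)).
  exact: has_meanD.
by apply/funext => w; rewrite big_cons.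
Qed.

Lemma has_mean_le f g u v :
  has_mean f u -> has_mean g v -> (forall w, f w <= g w) -> u <= v.
Proof.
move=> [intf fE] [intg gE] fg; rewrite -lee_fin -fE -gE.
by apply: le_integral => // w _; rewrite lee_fin.
Qed.

(** Expectations are taken in a pointwise inequality; Markov's and Chernoff's bounds below follow by
    choosing the finite family [B]. *)
Lemma indic_bound (J : Type) (s : seq J) (e : J -> R) (A : set T) (B : J -> set T) :
    measurable A -> (forall j, measurable (B j)) ->
    (forall w, \1_A w <= \sum_(j <- s) e j * \1_(B j) w) ->
  pr A <= \sum_(j <- s) e j * pr (B j).
Proof.
move=> mA mB le_AB.
apply: (has_mean_le (has_mean_indic mA) _ le_AB).
by apply: has_mean_sum => j; exact/has_meanZ/has_mean_indic.
Qed.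

Lemma pr_bigcup_nondecreasing (B : nat -> set T) (y : R) :
    (forall m, measurable (B m)) -> {homo B : m n / (m <= n)%N >-> m `<=` n} ->
    (forall m, pr (B m) <= y) ->
  pr (\bigcup_m B m) <= y.
Proof.
move=> mB homoB le_y.
have mU : measurable (\bigcup_m B m) by exact: bigcup_measurable.
rewrite -lee_fin -prE//.
have cvgB : (P \o B) x @[x --> \oo] --> P (\bigcup_m B m).
  apply: nondecreasing_cvg_mu => // m n mn; apply/subsetPset; exact: homoB.
rewrite -(cvg_lim _ cvgB)//; apply: lime_le.
  by apply/cvg_ex; exists (P (\bigcup_m B m)).
by near=> m; rewrite /= prE// lee_fin.
Unshelve. all: by end_near. Qed.

(** The event that the whole series of indicators is above [y]. Partial sums are nondecreasing, so
    it is an increasing union and no infinite sum is formed. *)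
Definition exceeds (A : nat -> set T) (y : R) : set T :=
  \bigcup_m [set w | y < \sum_(j < m) \1_(A j) w].

Lemma measurable_sum_indic_gt (I : Type) (r : seq I) (c : I -> R)
    (A : I -> set T) (y : R) :
  (forall i, measurable (A i)) ->
  measurable [set w | y < \sum_(i <- r) c i * \1_(A i) w].
Proof.
move=> mA.
have mf : measurable_fun setT (fun w => \sum_(i <- r) c i * \1_(A i) w : R).
  apply: measurable_sum => i; apply: measurable_funM => //.
have := mf measurableT _ (measurable_itv `]y, +oo[).
rewrite setTI; set S := (X in measurable X -> _).
suff -> : [set w | y < \sum_(i <- r) c i * \1_(A i) w] = S by [].
by rewrite /S; apply/seteqP; split => w /=; rewrite in_itv/= andbT.
Qed.

Lemma measurable_partial_exceeds (A : nat -> set T) (y : R) (m : nat) :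
  (forall j, measurable (A j)) ->
  measurable [set w | y < \sum_(j < m) \1_(A j) w].
Proof.
move=> mA.
have := @measurable_sum_indic_gt _ (index_enum 'I_m) (fun=> 1) A y mA.
set S := (X in measurable X -> _).
suff -> : [set w | y < \sum_(j < m) \1_(A j) w] = S by [].
by apply/funext => w; rewrite /S/=; under [in RHS]eq_bigr do rewrite mul1r.
Qed.

Lemma measurable_exceeds (A : nat -> set T) (y : R) :
  (forall j, measurable (A j)) -> measurable (exceeds A y).
Proof.
by move=> mA; apply: bigcup_measurable => m _; exact: measurable_partial_exceeds.
Qed.

Lemma not_exceeds (A : nat -> set T) (y : R) w :
  ~ exceeds A y w -> forall m, \sum_(j < m) \1_(A j) w <= y.
Proof. by move=> nex m; rewrite leNgt; apply/negP => lt_y; apply: nex; exists m. Qed.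

Lemma pr_exceeds_le (A : nat -> set T) (y z : R) :
    (forall j, measurable (A j)) ->
    (forall m, pr [set w | y < \sum_(j < m) \1_(A j) w] <= z) ->
  pr (exceeds A y) <= z.
Proof.
move=> mA le_z; apply: pr_bigcup_nondecreasing => //.
  by move=> m; exact: measurable_partial_exceeds.
move=> m n mn w /= /lt_le_trans; apply.
rewrite -(subnKC mn) big_split_ord/= lerDl sumr_ge0// => j _.
Qed.

Lemma markov_exceeds (A : nat -> set T) (mu y : R) :
    (forall j, measurable (A j)) -> 0 < y ->
    (forall m, \sum_(j < m) pr (A j) <= mu) ->
  pr (exceeds A y) <= mu / y.
Proof.
move=> mA y0 le_mu; apply: pr_exceeds_le => // m.
apply: (@le_trans _ _ (\sum_(j < m) y^-1 * pr (A j))); last first.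
  by rewrite -mulr_sumr mulrC ler_wpM2r// invr_ge0 ltW.
apply: indic_bound => [||w]; first exact: measurable_partial_exceeds.
  by move=> j.
rewrite -mulr_sumr indicE; case: (boolP (w \in _)) => [|_]; last first.
  by apply: mulr_ge0; [rewrite invr_ge0 ltW|exact: sumr_ge0].
by rewrite inE/= => lty; rewrite mulrC ler_pdivlMr// mul1r ltW.
Qed.

(** Expanding the product gives the sum over finite sets [S] of [expR (th * #|S|%:R)] times the
    probability that all [A j] with [j] in [S] occur. Only probabilities of finite intersections
    enter, at the price of the factor [1 + expR th * p] in place of [1 + (expR th - 1) * p]. *)
Lemma chernoff_exceeds (A : nat -> set T) (th y z : R) :
    (forall j, measurable (A j)) -> 0 <= th ->
    (forall s : seq nat, uniq s ->
       pr (\bigcap_(j in [set` s]) A j) = \prod_(j <- s) pr (A j)) ->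
    (forall m, \prod_(j < m) (1 + expR th * pr (A j)) <= z) ->
  pr (exceeds A y) <= expR (- (th * y)) * z.
Proof.
move=> mA th0 indepA le_z; apply: pr_exceeds_le => // m.
apply: (@le_trans _ _ (expR (- (th * y)) * \prod_(j < m) (1 + expR th * pr (A j))));
  last by rewrite ler_wpM2l// expR_ge0.
pose s (S : {set 'I_m}) := [seq val j | j <- enum S].
have us S : uniq (s S) by rewrite map_inj_uniq ?enum_uniq//; exact: val_inj.
pose C S := \bigcap_(j in [set` s S]) A j.
have mC S : measurable (C S) by apply: fin_bigcap_measurable.
apply: (@le_trans _ _ (\sum_(S : {set 'I_m})
    (expR (- (th * y)) * expR (th * #|S|%:R)) * pr (C S))); last first.
  rewrite le_eqVlt; apply/orP; left; apply/eqP.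
  under eq_bigr do rewrite -mulrA.
  rewrite -mulr_sumr; congr (_ * _).
  under [RHS]eq_bigr do rewrite addrC.
  rewrite bigA_distr; apply: eq_bigr => S _.
  rewrite indepA// big_map big_enum/= -big_mkcond/= big_split/=.
  rewrite prodr_const; congr (_ * _).
  by rewrite expRM_natr.
(* If the events occurring at [w] are those indexed by [S], then [w] lies in
   [C S] and [#|S| > y]. *)
apply: indic_bound => // [|w]; first exact: measurable_partial_exceeds.
rewrite indicE; case: (boolP (w \in _)) => [|_]; last first.
  by apply: sumr_ge0 => S _; rewrite !mulr_ge0 ?expR_ge0.
rewrite inE/= => lty.
pose S := [set j : 'I_m | w \in A j]%SET.
rewrite (bigD1 S)//= -[leLHS]addr0 lerD//; last first.
  by apply: sumr_ge0 => ? _; rewrite !mulr_ge0 ?expR_ge0.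
have -> : \1_(C S) w = 1 :> R.
  rewrite indicE mem_set// => j /= /mapP[i]; rewrite mem_enum inE => wA ->.
  exact: set_mem.
rewrite mulr1 -expRD -[leLHS]expR0 ler_expR.
suff : y <= #|S|%:R by move=> yS; rewrite addrC -mulrBr mulr_ge0// subr_ge0.
apply: ltW; apply: (lt_le_trans lty).
rewrite -sum1_card natr_sum [leRHS]big_mkcond/=; apply: ler_sum => j _.
by rewrite indicE inE; case: (w \in A j).
Qed.

Lemma pr_setU A B : measurable A -> measurable B -> pr (A `|` B) <= pr A + pr B.
Proof.
move=> mA mB.
have mAB : measurable (A `|` B) by exact: measurableU.
have mean_sum := has_meanD (has_mean_indic mA) (has_mean_indic mB).
apply: (has_mean_le (has_mean_indic mAB) mean_sum) => w.
rewrite !indicE in_setU.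
by case: (w \in A); case: (w \in B); rewrite ?addr0 ?add0r ?lerDl.
Qed.

(* Chebyshev's inequality bounds below the number of the [A b] that occur, and
   Markov's inequality bounds above the total number of the [E b j] that occur
   together with [A b]; when both bounds hold, some [A b] occurs together with
   few of the [E b j]. *)
Lemma second_moment (n : nat) (A : nat -> set T) (E : nat -> nat -> set T)
    (q mu M : R) (e : nat -> R) :
    (forall b, measurable (A b)) -> (forall b j, measurable (E b j)) ->
    (0 < n)%N -> 0 < q -> 0 < M ->
    (forall b, (b < n)%N -> pr (A b) = q) ->
    (forall b b', (b < n)%N -> (b' < n)%N -> b != b' ->
       pr (A b `&` A b') = q ^+ 2) ->
    (forall b j, (b < n)%N -> pr (A b `&` E b j) = q * e j) ->
    (forall m, \sum_(j < m) e j <= mu) ->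
  exists C, [/\ measurable C, pr C <= 4 / (n%:R * q) + 2 * mu / M &
    forall w, ~ C w -> exists2 b, (b < n)%N &
      A b w /\ forall m, \sum_(j < m) \1_(E b j) w <= M].
Proof.
move=> mA mE n0 q0 M0 prA prAA prAE le_mu.
have nq0 : 0 < n%:R * q by rewrite mulr_gt0// ltr0n.
pose N w := \sum_(b < n) \1_(A b) w : R.
(* The coefficients [-1] turn a lower tail of [N] into an upper level set, for which measurability
   is available. *)
pose few := [set w | - (n%:R * q / 2) < \sum_(b < n) -1 * \1_(A b) w].
have fewE w : few w <-> N w < n%:R * q / 2.
  by rewrite /few /= -mulr_sumr mulN1r ltrN2.
have mfew : measurable few by exact: measurable_sum_indic_gt.
pose S m w := \sum_(b < n) \sum_(j < m) \1_(A b `&` E b j) w : R.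
pose many m := [set w | M * (n%:R * q) / 2 < S m w].
have mmany m : measurable (many m).
  have -> : many m = [set w | M * (n%:R * q) / 2 <
      \sum_(p : 'I_n * 'I_m) 1 * \1_(A p.1 `&` E p.1 p.2) w].
    apply/funext => w; rewrite /many/S/= pair_bigA/=.
    by under [in RHS]eq_bigr do rewrite mul1r.
  by apply: (measurable_sum_indic_gt _ _ (A := fun p : 'I_n * 'I_m =>
    A p.1 `&` E p.1 p.2)) => p; exact: measurableI.
have pr_few : pr few <= 4 / (n%:R * q).
  have meanN : has_mean N (n%:R * q).
    rewrite (_ : n%:R * q = \sum_(b < n) pr (A b)).
      by apply: has_mean_sum => b; exact: has_mean_indic.
    by under eq_bigr => b _ do rewrite prA//; rewrite sumr_const card_ord mulr_natl.
  pose NN w := \sum_(b < n) \sum_(b' < n) \1_(A b `&` A b') w : R.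
  have NNE w : NN w = N w ^+ 2.
    rewrite expr2 /NN /N big_distrl/=; apply: eq_bigr => b _.
    by rewrite big_distrr/=; apply: eq_bigr => b' _; rewrite indicI.
  have meanNN : has_mean NN (\sum_(b < n) \sum_(b' < n) pr (A b `&` A b')).
    apply: has_mean_sum => b; apply: has_mean_sum => b'.
    by apply: has_mean_indic; exact: measurableI.
  (* Diagonal pairs contribute [q] each and the other pairs at most [q ^+ 2], so the variance of [N]
     is at most [n%:R * q]. *)
  have le_var : \sum_(b < n) \sum_(b' < n) pr (A b `&` A b') <=
      n%:R * q + (n%:R * q) ^+ 2.
    have -> : n%:R * q + (n%:R * q) ^+ 2 = \sum_(b < n) (q + n%:R * q ^+ 2).
      by rewrite sumr_const card_ord -mulr_natl; ring.
    apply: ler_sum => b _; rewrite (bigD1 b)//= setIid prA// lerD2l.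
    apply: (@le_trans _ _ (\sum_(b' < n) q ^+ 2)); last first.
      by rewrite sumr_const card_ord mulr_natl.
    rewrite [leRHS](bigD1 b)//= -[leLHS]add0r lerD// ?sqr_ge0//.
    by apply: ler_sum => b' b'b; rewrite prAA// eq_sym.
  have := has_mean_le (has_meanZ ((n%:R * q / 2) ^+ 2) (has_mean_indic mfew))
    (has_meanD meanNN (has_meanD (has_meanZ (- (2 * (n%:R * q))) meanN)
      (has_mean_cst ((n%:R * q) ^+ 2)))).
  have sq w : (n%:R * q / 2) ^+ 2 * \1_few w <=
      NN w + (- (2 * (n%:R * q)) * N w + (n%:R * q) ^+ 2).
    have -> : NN w + (- (2 * (n%:R * q)) * N w + (n%:R * q) ^+ 2) =
        (n%:R * q - N w) ^+ 2 by rewrite NNE; ring.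
    rewrite indicE; case: (boolP (w \in few)) => [/set_mem/fewE few_w|_].
      rewrite mulr1 ler_sqr ?nnegrE; first by lra.
        by rewrite divr_ge0// ltW.
      lra.
    by rewrite mulr0 sqr_ge0.
  move=> /(_ sq) le_few.
  rewrite ler_pdivlMr//; move: le_var le_few nq0.
  set v := \sum_(b < n) _; set x := n%:R * q; set p := pr few => le_var le_few x0.
  have : x * (p * x) <= x * 4 by nra.
  by rewrite ler_pM2l.
have pr_many : pr (\bigcup_m many m) <= 2 * mu / M.
  apply: pr_bigcup_nondecreasing => // [m m' mm' w /= /lt_le_trans|m].
    apply; rewrite /S; apply: ler_sum => b _.
    by rewrite -(subnKC mm') big_split_ord/= lerDl sumr_ge0// => j _.
  have meanS : has_mean (S m) (\sum_(b < n) \sum_(j < m) (q * e j)).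
    rewrite (_ : \sum_(b < n) _ = \sum_(b < n) \sum_(j < m) pr (A b `&` E b j)).
      apply: has_mean_sum => b; apply: has_mean_sum => j.
      by apply: has_mean_indic; exact: measurableI.
    by apply: eq_bigr => b _; apply: eq_bigr => j _; rewrite prAE.
  have := has_mean_le (has_meanZ (M * (n%:R * q) / 2) (has_mean_indic (mmany m))) meanS.
  have le_S w : M * (n%:R * q) / 2 * \1_(many m) w <= S m w.
    rewrite indicE; case: (boolP (w \in many m)) => [/set_mem|_].
      by rewrite mulr1 => /ltW.
    by rewrite mulr0 sumr_ge0// => b _; exact: sumr_ge0.
  move=> /(_ le_S).
  rewrite sumr_const card_ord -mulr_sumr -mulr_natl => le_e.
  have {}le_e : n%:R * q * (M * pr (many m) / 2) <= n%:R * q * \sum_(j < m) e j by lra.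
  rewrite ler_pM2l// in le_e.
  rewrite ler_pdivlMr//; have := le_mu m.
  by move: le_e; lra.
have mU : measurable (\bigcup_m many m) by exact: bigcup_measurable.
exists (few `|` \bigcup_m many m); split; first exact: measurableU.
  by apply: (le_trans (pr_setU _ _)) => //; exact: lerD.
move=> w /not_orP[few_w nmany].
have geN : n%:R * q / 2 <= N w by rewrite leNgt; apply/negP => /fewE.
(* Otherwise every [A b] that occurs comes with more than [M] of the [E b j], and already within a
   common number [m] of terms; then [S m w] exceeds [M * N w], against the bound that holds outside
   [many m]. *)
apply: contrapT => noA.
have large b : exists m, (b < n)%N -> A b w -> M < \sum_(j < m) \1_(E b j) w.
  apply: contrapT => /forallNP noM; apply: noA.
  have /not_implyP[bn /not_implyP[Ab _]] := noM 0%N.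
  exists b => //; split=> // m; rewrite leNgt; apply/negP => ltM.
  by apply: (noM m).
have [f fP] := choice large.
pose m := (\max_(b < n) f b)%N.
have ge_f (b : 'I_n) : A b w -> M < \sum_(j < m) \1_(E b j) w.
  move=> Ab; apply: (lt_le_trans (fP b (ltn_ord b) Ab)).
  have fm : (f b <= m)%N by exact: leq_bigmax.
  by rewrite -(subnKC fm) big_split_ord/= lerDl sumr_ge0// => j _.
have leS : S m w <= M * N w.
  apply: (@le_trans _ _ (M * (n%:R * q / 2))).
    by rewrite mulrA leNgt; apply/negP => ltS; apply: nmany; exists m.
  by rewrite ler_pM2l.
have [b0 Ab0] : exists b : 'I_n, A b w.
  apply: contrapT => /forallNP noAw.
  have : N w = 0 by apply: big1 => b _; rewrite indicE memNset.
  by move: geN; lra.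
suff : M * N w < S m w by rewrite ltNge leS.
have SE b : \sum_(j < m) \1_(A b `&` E b j) w = \1_(A b) w * \sum_(j < m) \1_(E b j) w :> R.
  by rewrite mulr_sumr; apply: eq_bigr => j _; rewrite indicI.
rewrite /S /N mulr_sumr (bigD1 b0)//= [ltRHS](bigD1 b0)//= ltr_leD//.
  by rewrite SE indicE mem_set// mulr1 mul1r ge_f.
apply: ler_sum => b _; rewrite SE indicE.
case: (boolP (w \in A b)) => [/set_mem Ab|_]; last by rewrite mulr0 mul0r.
by rewrite mulr1 mul1r ltW// ge_f.
Qed.

End sums_of_indicators.

(** * Pathwise bounds on the workload *)

Section workload_bounds.
Context (R : realType).

(** Every counted customer is some [phi j] with [b j], and [phi] is injective, so the unordered sum
    is dominated by a series over [nat], whose partial sums are bounded by [y]. *)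
Lemma esum_bool_le (D : set int) (q : int -> bool) (phi : nat -> int)
    (b : nat -> bool) (y : R) :
    injective phi -> (forall i, D i -> q i -> exists2 j, b j & phi j = i) ->
    (forall m, \sum_(j < m) (b j)%:R <= y) ->
  (\esum_(i in D) (q i)%:R%:E <= y%:E)%E.
Proof.
move=> phi_inj Dq le_y.
have -> : \esum_(i in D) (q i)%:R%:E =
    \esum_(i in [set: int]) (if i \in D `&` [set i | q i] then 1 else 0 : \bar R)%E.
  rewrite esum_mkcond; apply: eq_esum => i _; rewrite in_setI.
  case: (i \in D) => //=; rewrite (_ : (i \in [set i | q i]) = q i); last first.
    by apply/idP/idP; rewrite inE.
  by case: (q i).
apply: (@le_trans _ _ (\esum_(i in phi @` [set j | b j]) (1 : \bar R))%E).
  rewrite [leRHS]esum_mkcond; apply: le_esum => i _.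
  case: ifPn => [|_]; last by case: ifP.
  by rewrite inE => -[Di qi]; rewrite mem_set//; have [j] := Dq i Di qi; exists j.
rewrite esum_image//; last by move=> i j _ _; exact: phi_inj.
have -> : \esum_(i in [set j | b j]) (1 : \bar R)%E =
    \esum_(i in [set: nat]) (b i)%:R%:E.
  rewrite esum_mkcond; apply: eq_esum => i _.
  rewrite (_ : (i \in [set j | b j]) = b i); last first.
    by apply/idP/idP; rewrite inE.
  by case: (b i).
rewrite -nneseries_esumT//; apply: lime_le; first exact: is_cvg_nneseries.
by near=> m; rewrite sumEFin lee_fin big_mkord.
Unshelve. all: by end_near. Qed.

Context (T : Type) (xi : int -> T -> R) (U : T -> R).
Implicit Types (w : T) (k i : int).

(* If [0 <= U <= 1], then customer [k + 1 - j] can only be late at some time in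
   [k, k + 1] when its delay exceeds [j - 2], and customer [k + j] can only be
   early at time [k] when its delay is at most [- j]. *)
Definition late_bound k (y : R) w :=
  forall m, \sum_(j < m) (j%:R - 2 < xi (k + 1 - j%:Z) w)%R%:R <= y.

Definition early_bound k (y : R) w :=
  forall m, \sum_(j < m) (xi (k + j%:Z) w <= - j%:R)%R%:R <= y.

Lemma late_le k (s y : R) w : 0 <= U w <= 1 -> k%:~R <= s <= (k + 1)%:~R ->
  late_bound k y w -> (late xi U s w <= y%:E)%E.
Proof.
move=> /andP[U0 U1] /andP[ks sk] le_y.
apply: (@esum_bool_le _ _ (fun j : nat => k + 1 - j%:Z)
  (fun j => (j%:R - 2 < xi (k + 1 - j%:Z) w)%R)) => // [i j|i /= iU xiU]; first lia.
have ik : i <= k + 1 by rewrite -(ler_int R); lra.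
exists (absz (k + 1 - i)%R); last by lia.
have -> : k + 1 - (absz (k + 1 - i)%R)%:Z = i by lia.
rewrite natr_absz ger0_norm; last by lia.
rewrite rmorphB rmorphD /=.
lra.
Qed.

Lemma early_le k (y : R) w : 0 <= U w <= 1 ->
  early_bound k y w -> (early xi U k%:~R w <= y%:E)%E.
Proof.
move=> /andP[U0 U1] le_y.
apply: (@esum_bool_le _ _ (fun j : nat => k + j%:Z)
  (fun j => (xi (k + j%:Z) w <= - j%:R)%R)) => // [i j|i /= iU xiU]; first lia.
have ik : k < i + 1 by rewrite -(ltr_int R) rmorphD/=; lra.
exists (absz (i - k)%R); last by lia.
have -> : k + (absz (i - k)%R)%:Z = i by lia.
rewrite natr_absz ger0_norm; last by lia.
rewrite rmorphB /=.
lra.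
Qed.

(** Customer [k - j.+1] is scheduled by time [k] because [U w <= 1], and a delay above [j.+1] puts
    its arrival after [k] because [0 <= U w]. *)
Lemma late_ge k (n : nat) w : 0 <= U w <= 1 ->
    (forall j, (j < n)%N -> j.+1%:R < xi (k - j.+1%:Z) w) ->
  (n%:R%:E <= late xi U k%:~R w)%E.
Proof.
move=> /andP[U0 U1] xi_gt.
pose phi (j : nat) : int := k - j.+1%:Z.
apply: (@le_trans _ _ (\esum_(i in phi @` `I_n) (1 : \bar R)))%E.
  rewrite esum_image//; last by move=> i j _ _; rewrite /phi; lia.
  rewrite esum_fset//.
  by rewrite -(fsbig_ord _ _ (fun=> 1%E)) sumEFin sumr_const card_ord.
rewrite /late esum_mkcond [leRHS]esum_mkcond; apply: le_esum => i _.
case: ifPn => [|_]; last by case: ifPn; rewrite // lee_fin ler0n.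
rewrite inE => -[j /= jn <-]; have := xi_gt j jn; rewrite -/(phi j) => xij.
have phiE : (phi j)%:~R = k%:~R - j%:R - 1 :> R.
  by rewrite /phi rmorphB /= -pmulrn -addn1 natrD; ring.
have j0 : 0 <= j%:R :> R by [].
have jS : j.+1%:R = j%:R + 1 :> R by rewrite -addn1 natrD.
rewrite mem_set /=; last by rewrite phiE; lra.
have lt_k : k%:~R < (phi j)%:~R + xi (phi j) w + U w by rewrite phiE; lra.
by rewrite lt_k.
Qed.

Lemma sched_offset_bound (t : R) w : -1 <= sched_offset U t w <= 1.
Proof.
have t1 := ge_floor t; have := floorD1_gt t; rewrite rmorphD/= => t2.
by rewrite /sched_offset; case: (U w <= _)%R => /=; lra.
Qed.

Let net_input rho (t s : R) w :=
  (early xi U t w - early xi U s w - late xi U t w + late xi U s w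
          + (sched_offset U t w)%:E - (sched_offset U s w)%:E
          - ((1 - rho) / rho * (t - s))%:E)%E.

Lemma late_ge0 s w : (0 <= late xi U s w)%E.
Proof. by apply: esum_ge0 => i _; rewrite lee_fin. Qed.

Lemma early_ge0 s w : (0 <= early xi U s w)%E.
Proof. by apply: esum_ge0 => i _; rewrite lee_fin. Qed.

Lemma ge0_le_fin (x : \bar R) (y : R) : (0 <= x)%E -> (x <= y%:E)%E ->
  exists2 r : R, x = r%:E & 0 <= r <= y.
Proof. by case: x => // r; rewrite !lee_fin => r0 ry; exists r; rewrite ?r0. Qed.

(** For [s] in [[k, k + 1]] the drift over [[s, n]] cancels the allowance
    [(1 - rho) / rho * (n - k)] in the bound on [late s] up to [1]; the two offsets cost at most
    [2]. This gives the constant [3]. *)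
Lemma workload_sup_le (rho z y : R) (n : nat) w :
    0 <= U w <= 1 -> 0 <= (1 - rho) / rho <= 1 ->
    early_bound n z w ->
    (forall k : nat, (k <= n)%N -> late_bound k (y + (1 - rho) / rho * (n - k)%:R) w) ->
  (ereal_sup [set net_input rho n%:R s w | s in `[0%R, n%:R]] <= (z + y + 3)%:E)%E.
Proof.
set r := (1 - rho) / rho => U01 /andP[r0 r1] le_z le_y.
apply: ge_ereal_sup => _ [s /= + <-]; rewrite in_itv/= => /andP[s0 sn].
have [e eE /andP[e0 ez]] := ge0_le_fin (early_ge0 _ w) (early_le U01 le_z).
have [l lE /andP[l0 ly]] : exists2 l : R, late xi U n%:R w = l%:E & 0 <= l <= y.
  have := le_y n (leqnn n); rewrite subnn mulr0 addr0 => /(late_le U01) ly.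
  apply: ge0_le_fin; first exact: late_ge0.
  by apply: ly; rewrite lexx/= rmorphD/= lerDl.
pose k := Num.truncn s.
have /andP[ks sk] : k%:R <= s < k.+1%:R by exact: truncn_itv.
have kn : (k <= n)%N by rewrite -(ler_nat R); lra.
have [l' l'E /andP[l'0 l'y]] :
    exists2 l : R, late xi U s w = l%:E & 0 <= l <= y + r * (n - k)%:R.
  apply: ge0_le_fin; first exact: late_ge0.
  apply: (late_le U01 _ (le_y k kn)).
  by rewrite ks rmorphD/= natr1 ltW.
have /andP[at1 at2] := sched_offset_bound n%:R w.
have /andP[as1 as2] := sched_offset_bound s w.
rewrite /net_input -/r eE lE l'E.
have : (0 <= early xi U s w)%E by exact: early_ge0.
(* An infinite [early s] makes the net input [-oo], which satisfies any upper bound. *)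
case: (early xi U s w) => [e'|_|//]; last by rewrite leNye.
rewrite lee_fin => e'0; rewrite lee_fin.
move: l'y; rewrite natrB// => l'y.
have : r * (s - k%:R) <= 1.
  have sk1 : s - k%:R <= 1 by move: sk; rewrite -natr1; lra.
  by rewrite -[leRHS]mulr1 ler_pM// subr_ge0.
nra.
Qed.

(** The condition [0 <= z + y + 3] takes care of the default value [0] of [fine] at [-oo]. *)
Lemma workload_le (rho z y : R) (n : nat) w :
    0 <= U w <= 1 -> 0 <= (1 - rho) / rho <= 1 -> 0 <= z + y + 3 ->
    early_bound n z w ->
    (forall k : nat, (k <= n)%N -> late_bound k (y + (1 - rho) / rho * (n - k)%:R) w) ->
  workload xi U rho n%:R w <= z + y + 3.
Proof.
move=> U01 r01 zy le_z le_y; have := workload_sup_le U01 r01 le_z le_y.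
by rewrite /workload -/(net_input _ _ _ _); case: ereal_sup => [r| |]//.
Qed.

(** The net input is evaluated at [s = k], where [m] customers are late; the [2] pays for the
    offsets. The upper bounds at all times keep the supremum finite, since [fine] would send [+oo]
    to [0]. *)
Lemma workload_ge (rho z y e l : R) (n k m : nat) w :
    0 <= U w <= 1 -> 0 <= (1 - rho) / rho <= 1 ->
    early_bound n z w ->
    (forall k : nat, (k <= n)%N -> late_bound k (y + (1 - rho) / rho * (n - k)%:R) w) ->
    (k <= n)%N -> early_bound k e w -> late_bound n l w ->
    (forall j, (j < m)%N -> j.+1%:R < xi (k%:Z - j.+1%:Z) w) ->
  m%:R - e - l - 2 - (1 - rho) / rho * (n - k)%:R <= workload xi U rho n%:R w.
Proof.
set r := (1 - rho) / rho => U01 r01 le_z le_y kn le_e le_l ge_m.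
have sup_le := workload_sup_le U01 r01 le_z le_y.
have [en enE /andP[en0 enz]] := ge0_le_fin (early_ge0 _ w) (early_le U01 le_z).
have [ek ekE /andP[ek0 eke]] := ge0_le_fin (early_ge0 _ w) (early_le U01 le_e).
have [ln lnE /andP[ln0 lnl]] : exists2 l' : R, late xi U n%:R w = l'%:E & 0 <= l' <= l.
  apply: ge0_le_fin; first exact: late_ge0.
  by apply: (late_le U01 _ le_l); rewrite lexx/= rmorphD/= lerDl.
have [lk lkE /andP[lk0 lky]] :
    exists2 l : R, late xi U k%:R w = l%:E & 0 <= l <= y + r * (n - k)%:R.
  apply: ge0_le_fin; first exact: late_ge0.
  apply: (late_le U01 _ (le_y k kn)).
  by rewrite lexx/= rmorphD/= natr1 ler_nat.
have /andP[at1 at2] := sched_offset_bound n%:R w.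
have /andP[as1 as2] := sched_offset_bound k%:R w.
have := late_ge U01 ge_m; rewrite lkE lee_fin => m_le.
have sup_ge : ((m%:R - e - l - 2 - r * (n - k)%:R)%:E <=
    ereal_sup [set net_input rho n%:R s w | s in `[0%R, n%:R]])%E.
  apply: (@le_trans _ _ (net_input rho n%:R k%:R w)); last first.
    by apply: ereal_sup_ubound; exists k%:R => //=; rewrite in_itv/= ler0n ler_nat.
  rewrite /net_input -/r enE ekE lnE lkE lee_fin natrB//; lra.
move: sup_le sup_ge; rewrite /workload -/(net_input _ _ _ _).
by case: ereal_sup => [x| |]//=; rewrite !lee_fin.
Qed.

End workload_bounds.

(** * Estimates on powers *)

Section power_estimates.
Context (R : realType).
Implicit Types (u b x s : R).

Lemma powR_expR x b : 0 < x -> x `^ b = expR (b * ln x).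
Proof. by move=> x0; rewrite /powR gt_eqF. Qed.

(** For [u <= 1], use [1 + u <= expR u] and [u <= powR u b]. For [u > 1], use
    [1 + u <= 2 * u <= expR b^-1 * u] and [1 + b * ln u <= powR u b]. *)
Lemma le1D_expR_powR u b : 0 <= u -> 0 < b -> b <= 1 ->
  1 + u <= expR (b^-1 * u `^ b).
Proof.
move=> u0 b0 b1; have bV1 : 1 <= b^-1 by rewrite invf_ge1.
have [->|u_neq0] := eqVneq u 0.
  by rewrite addr0 -[leLHS]expR0 ler_expR mulr_ge0 ?powR_ge0// invr_ge0 ltW.
have {u_neq0}u0 : 0 < u by rewrite lt_def u_neq0.
have [u1|u1] := leP u 1.
  apply: (le_trans (expR_ge1Dx u)); rewrite ler_expR.
  apply: (@le_trans _ _ (u `^ b)); last by rewrite ler_peMl// powR_ge0.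
  rewrite -[leLHS]lnK ?posrE// powR_expR// ler_expR.
  by have := ln_le0 u1; nra.
apply: (@le_trans _ _ (expR (b^-1 + ln u))).
  rewrite expRD lnK ?posrE//.
  have : 2 <= expR b^-1 by have := expR_ge1Dx b^-1; lra.
  by nra.
rewrite ler_expR -(ler_pM2l b0) mulrDr mulrA divff ?gt_eqF// mul1r.
by rewrite powR_expR// expR_ge1Dx.
Qed.

(** A discrete integral comparison: with [t = s - 1], the term at [x] times [t] is at most the
    decrease of the power [- t] from [x - 1] to [x], and these decreases telescope. *)
Lemma sum_powRN_le s m : 1 < s ->
  \sum_(j < m) (j.+1%:R : R) `^ (- s) <= 1 + (s - 1)^-1.
Proof.
move=> s1; pose t := s - 1; have t0 : 0 < t by rewrite subr_gt0.
have step x : 1 < x -> t * x `^ (- s) <= (x - 1) `^ (- t) - x `^ (- t).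
  move=> x1; have x0 : 0 < x by lra.
  have y0 : 0 < x - 1 by lra.
  have -> : x `^ (- s) = x `^ (- t) / x.
    rewrite -{3}(powRr1 (ltW x0)) -powRN -powRD; last by rewrite (gt_eqF x0) implybT.
    by congr (_ `^ _); rewrite /t; ring.
  have ln_y : ln (x - 1) <= ln x - x^-1.
    have yx : 0 < (x - 1) / x by rewrite divr_gt0.
    have -> : x - 1 = x * ((x - 1) / x) by rewrite mulrCA divff ?gt_eqF// mulr1.
    rewrite lnM ?posrE// lerD2l.
    have := expR_ge1Dx (ln ((x - 1) / x)); rewrite lnK ?posrE//.
    by rewrite mulrBl divff ?gt_eqF// mul1r; lra.
  have : x `^ (- t) * expR (t / x) <= (x - 1) `^ (- t).
    by rewrite !powR_expR// -expRD ler_expR; nra.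
  have := expR_ge1Dx (t / x); have := powR_ge0 x (- t).
  set e := expR _; set p := x `^ (- t); set q := _ `^ (- t).
  have -> : t * (p / x) = p * (t / x) by ring.
  by set v := t / x; nra.
have tel n : t * \sum_(j < n) (j.+1%:R : R) `^ (- s) <=
    t + 1 - (if n is 0%N then 0 else n%:R `^ (- t)).
  elim: n => [|n IH]; first by rewrite big_ord0 mulr0; lra.
  rewrite big_ord_recr/= mulrDr; case: n IH => [_|n IH].
    by rewrite big_ord0 mulr0 add0r !powR1; lra.
  have nE : n.+2%:R - 1 = n.+1%:R :> R by rewrite -natr1 addrK.
  have := step n.+2%:R; rewrite nE ltr1n => /(_ isT).
  by move: IH; lra.
rewrite -(ler_pM2l t0) mulrDr mulr1 divff ?gt_eqF//.
apply: (le_trans (tel m)); case: m => [|m]; first by rewrite subr0.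
by rewrite gerDl oppr_le0 powR_ge0.
Qed.

Lemma sum_powR_tail_le (g : R -> R) (D a x0 b : R) :
    (forall x, 0 <= g x <= 1) -> 0 < x0 -> 0 < D -> 0 < a -> 0 < b -> 1 < a * b ->
    (forall x : R, x0 <= x -> g x <= D * x `^ (- a)) ->
  exists C, forall m, \sum_(j < m) g (j%:R - 2) `^ b <= C.
Proof.
move=> g01 x00 D0 a0 b0 ab1 gD.
(* From [J] on, both [x0 <= j - 2] and [(j + 1) / 2 <= j - 2] hold, so the power bound applies and
   the shift by [2] costs only a constant factor. Earlier terms are at most [1]. *)
pose s := a * b; pose J := (Num.truncn x0 + 6)%N.
pose C := D `^ b * 2 `^ s.
exists (J%:R + C * (1 + (s - 1)^-1)) => m.
have C0 : 0 <= C by rewrite mulr_ge0 ?powR_ge0.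
have term (j : nat) : g (j%:R - 2) `^ b <= (j < J)%N%:R + C * j.+1%:R `^ (- s).
  have /andP[g0 g1] := g01 (j%:R - 2).
  have pj0 : 0 <= C * j.+1%:R `^ (- s) by rewrite mulr_ge0 ?powR_ge0.
  case: ltnP => jJ /=.
    have : g (j%:R - 2) `^ b <= 1.
      rewrite [leRHS](_ : 1 = 1 `^ b); last by rewrite powR1.
      by apply: ge0_ler_powR; rewrite ?nnegrE//; exact: ltW.
    by lra.
  rewrite add0r.
  have jx : x0 <= j%:R - 2 /\ j.+1%:R / 2 <= j%:R - 2 :> R.
    move: jJ; rewrite -(ler_nat R) natrD -natr1 => jJ.
    have := ltW (truncnS_gt x0); rewrite -natr1 => tx.
    have := ler0n R (Num.truncn x0); split; lra.
  have y0 : 0 < j.+1%:R / 2 :> R by rewrite divr_gt0.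
  have lt0 : 0 < j%:R - 2 :> R by lra.
  apply: (@le_trans _ _ ((D * (j.+1%:R / 2) `^ (- a)) `^ b)).
    apply: ge0_ler_powR; rewrite ?nnegrE//; first exact: ltW.
      by rewrite mulr_ge0 ?powR_ge0// ltW.
    apply: (le_trans (gD _ jx.1)); rewrite ler_pM2l//.
    rewrite !powRN lef_pV2 ?posrE ?powR_gt0//.
    by apply: ge0_ler_powR jx.2; rewrite ?nnegrE; exact: ltW.
  rewrite powRM ?powR_ge0//; last exact: ltW.
  rewrite -powRrM mulNr -/s /C -mulrA ler_pM2l ?powR_gt0//.
  rewrite powRM// ?invr_ge0// [leLHS]mulrC ler_pM2r ?powR_gt0//.
  by rewrite -powR_inv1// -powRrM mulN1r opprK.
apply: (@le_trans _ _ (\sum_(j < m) ((j < J)%N%:R + C * j.+1%:R `^ (- s)))).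
  by apply: ler_sum => j _; exact: term.
rewrite big_split/= -mulr_sumr lerD// ?ler_wpM2l// ?sum_powRN_le//.
rewrite -natr_sum ler_nat.
elim: m => [|m IH]; first by rewrite big_ord0.
rewrite big_ord_recr/=; case: (ltnP m J) => mJ; last by rewrite addn0.
apply: (@leq_trans (m + 1)); last by rewrite addn1.
rewrite leq_add2r.
apply: (@leq_trans (\sum_(j < m) 1)%N).
  by apply: leq_sum => j _; case: (_ < _)%N.
by rewrite sum_nat_const card_ord muln1.
Qed.

Lemma sum_geometric_le (x : R) n : 0 <= x < 1 -> \sum_(k < n) x ^+ k <= (1 - x)^-1.
Proof.
move=> /andP[x0 x1]; have y0 : 0 < 1 - x by rewrite subr_gt0.
rewrite -[leRHS]mul1r ler_pdivlMr// mulrC.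
by rewrite -[1 - x]opprB mulNr -subrX1 opprB gerBl exprn_ge0.
Qed.

End power_estimates.

(** * Late and early customers *)

Section scheduled_arrivals.
Context (R : realType) (d : measure_display) (T : measurableType d)
  (P : probability T R) (xi : int -> {RV P >-> R}).
Local Notation pr := (pr P).

Lemma measurable_preim (X : {RV P >-> R}) (A : set R) :
  measurable A -> measurable (X @^-1` A).
Proof.
by move=> mA; rewrite -[X in measurable X]setTI; exact: measurable_funP.
Qed.

Definition late_event (k : int) (j : nat) : set T :=
  xi (k + 1 - j%:Z) @^-1` `]j%:R - 2, +oo[.

Definition early_event (k : int) (j : nat) : set T :=
  xi (k + j%:Z) @^-1` `]-oo, - j%:R].

Lemma measurable_late_event k j : measurable (late_event k j).
Proof. exact: measurable_preim. Qed.

Lemma measurable_early_event k j : measurable (early_event k j).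
Proof. exact: measurable_preim. Qed.

Lemma late_boundP k y w : late_bound xi k y w <->
  forall m, \sum_(j < m) \1_(late_event k j) w <= y.
Proof.
suff E m : \sum_(j < m) \1_(late_event k j) w =
    \sum_(j < m) (j%:R - 2 < xi (k + 1 - j%:Z) w)%R%:R :> R.
  by split=> le_y m; [rewrite E|rewrite -E].
apply: eq_bigr => j _; rewrite indicE; congr (nat_of_bool _)%:R.
by apply/idP/idP; rewrite inE/= /late_event/= in_itv/= andbT.
Qed.

Lemma early_boundP k y w : early_bound xi k y w <->
  forall m, \sum_(j < m) \1_(early_event k j) w <= y.
Proof.
suff E m : \sum_(j < m) \1_(early_event k j) w =
    \sum_(j < m) (xi (k + j%:Z) w <= - j%:R)%R%:R :> R.
  by split=> le_y m; [rewrite E|rewrite -E].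
apply: eq_bigr => j _; rewrite indicE; congr (nat_of_bool _)%:R.
by apply/idP/idP; rewrite inE/= /early_event/= in_itv.
Qed.

Lemma pr_not_unit_interval (U : {RV P >-> R}) : uniform01 U ->
  pr (U @^-1` ~` `[0, 1]) = 0.
Proof.
move=> U_unif; rewrite /pr.
have -> : P (U @^-1` ~` `[0, 1]) = distribution P U (~` `[0, 1]) by [].
rewrite U_unif; last exact: measurableC.
rewrite /uniform_prob integral0_eq// => x; rewrite /= in_itv/= => /negP.
by rewrite /uniform_pdf => /negbTE ->.
Qed.

Hypothesis xi_ident : identically_distributed xi.

Lemma pr_xi (i : int) (A : set R) : measurable A ->
  pr (xi i @^-1` A) = pr (xi 0 @^-1` A).
Proof.
by move=> mA; have := xi_ident i 0 mA;
  rewrite /pr /distribution/= /pushforward => ->.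
Qed.

Definition tail (x : R) : R := pr (xi 0 @^-1` `]x, +oo[).

Lemma tail01 x : 0 <= tail x <= 1.
Proof. by rewrite pr_ge0 pr_le1//; exact: measurable_preim. Qed.

Lemma tail_nonincreasing x y : x <= y -> tail y <= tail x.
Proof.
move=> xy; apply: le_pr; try exact: measurable_preim.
by move=> w /=; rewrite !in_itv/= !andbT; exact: le_lt_trans.
Qed.

Lemma pr_late_event k j : pr (late_event k j) = tail (j%:R - 2).
Proof. exact: pr_xi. Qed.

(** By identical distribution all events can be moved to customer [0]. The number of [j] with
    [xi 0 w <= - j] is then at most [1] plus the negative part of [xi 0 w], whose mean is finite. *)
Lemma sum_pr_early_event_le :
    ('E_P[(fun w => Num.max (- xi 0 w) 0)%R] < +oo)%E ->
  exists mu, forall k m, \sum_(j < m) pr (early_event k j) <= mu.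
Proof.
move=> mean_fin; pose f w := Num.max (- xi 0 w) 0.
have f0 w : 0 <= f w by rewrite le_max lexx orbT.
have mf : measurable_fun setT f.
  by apply: measurable_maxr => //; exact: measurableT_comp.
have fin : (\int[P]_w (f w)%:E < +oo)%E by move: mean_fin; rewrite unlock.
have mean_f : has_mean P f (fine (\int[P]_w (f w)%:E)).
  split; last by rewrite fineK// ge0_fin_numE// integral_ge0// => w _; rewrite lee_fin.
  apply/integrableP; split; first exact/measurable_EFinP.
  by under eq_integral do rewrite /= ger0_norm//.
exists (1 + fine (\int[P]_w (f w)%:E)) => k m.
have -> : \sum_(j < m) pr (early_event k j) = \sum_(j < m) pr (early_event 0 j).
  by apply: eq_bigr => j _; rewrite /early_event !(pr_xi (_ + _)).
have mean_sum : has_mean P (fun w => \sum_(j < m) \1_(xi 0 @^-1` `]-oo, - (j%:R : R)]) w)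
    (\sum_(j < m) pr (early_event 0 j)).
  rewrite (_ : \sum_(j < m) _ = \sum_(j < m) pr (xi 0 @^-1` `]-oo, - (j%:R : R)])); last first.
    by apply: eq_bigr => j _; rewrite /early_event pr_xi.
  by apply: has_mean_sum => j; apply: has_mean_indic; exact: measurable_preim.
apply: (has_mean_le mean_sum (has_meanD (has_mean_cst P 1) mean_f)) => w.
elim: m {mean_sum} => [|m IH]; first by rewrite big_ord0 addr_ge0.
rewrite big_ord_recr/= [X in _ + X]indicE.
case: (boolP (w \in _)) => [|_]; last by rewrite addr0.
rewrite inE/= in_itv/= => xm.
have : \sum_(j < m) \1_(xi 0 @^-1` `]-oo, - (j%:R : R)]) w <= m%:R :> R.
  apply: (@le_trans _ _ (\sum_(j < m) 1)); last by rewrite sumr_const card_ord.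
  by apply: ler_sum => j _; rewrite indicE lern1 leq_b1.
have : - xi 0 w <= f w by rewrite le_max lexx.
by lra.
Qed.

Hypothesis xi_indep : mutually_independent xi.

(** Carries independence over to events indexed through [phi]: the set [B] attached to [phi i] is
    [A i], which is consistent because [phi] is injective on [s]. *)
Lemma pr_bigcap_xi (I : eqType) (s : seq I) (phi : I -> int) (A : I -> set R) :
    uniq s -> {in s &, injective phi} -> (forall i, measurable (A i)) ->
  pr (\bigcap_(i in [set` s]) xi (phi i) @^-1` A i) =
  \prod_(i <- s) pr (xi (phi i) @^-1` A i).
Proof.
move=> us phi_inj mA; case: s us phi_inj => [|i0 s0] us phi_inj.
  by rewrite big_nil set_nil bigcap_set0 prT.
set s := i0 :: s0 in us phi_inj *.
pose B k := A (nth i0 s (index k (map phi s))).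
have BE i : i \in s -> B (phi i) = A i.
  by move=> si; rewrite /B nth_index_map.
have uphi : uniq (map phi s) by rewrite map_inj_in_uniq.
have := xi_indep uphi (fun k => mA _ : measurable (B k)).
have -> : \bigcap_(k in [set` map phi s]) xi k @^-1` B k =
    \bigcap_(i in [set` s]) xi (phi i) @^-1` A i.
  apply/seteqP; split => w /= capw.
    move=> i si; have phis : phi i \in map phi s by exact: map_f.
    by have := capw _ phis; rewrite /= BE.
  move=> k ks; have /mapP[i si ->] : k \in map phi s by [].
  by rewrite BE//; exact: capw.
rewrite big_map => E; rewrite {1}/pr E.
rewrite (eq_big_seq (fun i => (pr (xi (phi i) @^-1` A i))%:E)); last first.
  by move=> i si; rewrite BE// prE//; exact: measurable_preim.
by rewrite prodEFin.
Qed.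

(** By [le1D_expR_powR] with [u = expR th * p], each factor of the Chernoff product is at most an
    exponential; the exponents add up to a multiple of [C], uniformly in [k]. *)
Lemma chernoff_late k (th y b C : R) : 0 <= th -> 0 < b -> b <= 1 ->
    (forall m, \sum_(j < m) tail (j%:R - 2) `^ b <= C) ->
  pr (exceeds (late_event k) y) <= expR (- (th * y) + b^-1 * (expR (th * b) * C)).
Proof.
move=> th0 b0 b1 le_C; rewrite expRD.
apply: chernoff_exceeds => //.
- exact: measurable_late_event.
- move=> s us; apply: pr_bigcap_xi => //.
  by move=> i j _ _; lia.
move=> m; pose p j := tail (j%:R - 2).
apply: (@le_trans _ _ (\prod_(j < m) expR (b^-1 * (expR (th * b) * p j `^ b)))).
  apply: ler_prod => j _; rewrite pr_late_event -/(p j).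
  have /andP[p0 p1] := tail01 (j%:R - 2).
  have ep0 : 0 <= expR th * p j by rewrite mulr_ge0 ?expR_ge0.
  rewrite addr_ge0//= expRM -powRM ?expR_ge0//.
  exact: le1D_expR_powR.
rewrite -expR_sum ler_expR -mulr_sumr -mulr_sumr.
by rewrite ler_pM2l ?invr_gt0// ler_pM2l ?expR_gt0.
Qed.

End scheduled_arrivals.

(** * Probabilities of the exceptional events for the two workload bounds *)

Section workload_probabilities.
Context (R : realType) (d : measure_display) (T : measurableType d)
  (P : probability T R) (xi : int -> {RV P >-> R}) (U : {RV P >-> R}).
Hypotheses (xi_indep : mutually_independent xi)
  (xi_ident : identically_distributed xi) (U_unif : uniform01 U).
Local Notation pr := (pr P).
Local Notation tail := (tail xi).

Lemma pr_bigsetU_le n (A : nat -> set T) : (forall k, measurable (A k)) ->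
  pr (\big[setU/set0]_(k < n) A k) <= \sum_(k < n) pr (A k).
Proof.
move=> mA; elim: n => [|n IH]; first by rewrite !big_ord0 /pr measure0.
rewrite !big_ord_recr/=; apply: (le_trans (pr_setU _ _ _)) => //.
  by apply: bigsetU_measurable.
by rewrite lerD2r.
Qed.

(** Markov's inequality handles the early customers at time [n]. Chernoff's bound at time [k]
    carries the factor [expR (- (th * r))] to the power [n - k], so the union bound over [k] is a
    geometric series, bounded independently of [n]. *)
Lemma good_event_upper (n : nat) (r th y z b C mu : R) :
    0 < r -> 0 < th -> 0 < z -> 0 < b -> b <= 1 ->
    (forall m, \sum_(j < m) tail (j%:R - 2) `^ b <= C) ->
    (forall k m, \sum_(j < m) pr (early_event xi k j) <= mu) ->
  exists D, [/\ measurable D,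
    pr D <= mu / z + (1 + (th * r)^-1) * expR (- (th * y) + b^-1 * (expR (th * b) * C)) &
    forall w, ~ D w -> [/\ 0 <= U w <= 1, early_bound xi n z w &
      forall k : nat, (k <= n)%N -> late_bound xi k (y + r * (n - k)%:R) w]].
Proof.
move=> r0 th0 z0 b0 b1 le_C le_mu.
pose out := U @^-1` ~` `[0, 1].
have mout : measurable out by apply: measurable_preim; exact: measurableC.
pose early := exceeds (early_event xi n) z.
have mearly : measurable early.
  by apply: measurable_exceeds; exact: measurable_early_event.
pose late k := exceeds (late_event xi k%:Z) (y + r * (n - k)%:R).
have mlate k : measurable (late k).
  by apply: measurable_exceeds; exact: measurable_late_event.
pose lates := \big[setU/set0]_(k < n.+1) late k.
have mlates : measurable lates by exact: bigsetU_measurable.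
exists ((out `|` early) `|` lates); split; first exact/measurableU/mlates/measurableU.
  apply: (le_trans (pr_setU _ _ _)) => //; first exact: measurableU.
  apply: lerD.
    apply: (le_trans (pr_setU _ _ _)) => //.
    rewrite pr_not_unit_interval// add0r.
    by apply: markov_exceeds => //; exact: measurable_early_event.
  apply: (le_trans (pr_bigsetU_le _ _)) => //.
  pose c := expR (- (th * y) + b^-1 * (expR (th * b) * C)).
  pose x := expR (- (th * r)).
  apply: (@le_trans _ _ (\sum_(k < n.+1) c * x ^+ (n - k))).
    apply: ler_sum => k _.
    apply: (le_trans (chernoff_late xi_ident xi_indep _ _ (ltW th0) b0 b1 le_C)).
    by rewrite /c /x -expRM_natr -expRD ler_expR; lra.
  have thr0 : 0 < th * r by rewrite mulr_gt0.
  have x1 : x < 1 by rewrite /x -[ltRHS]expR0 ltr_expR oppr_lt0.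
  have x0 : 0 <= x by exact: expR_ge0.
  rewrite -mulr_sumr mulrC -/c ler_pM2r ?expR_gt0//.
  rewrite (reindex_inj rev_ord_inj)/=.
  under eq_bigr => k _ do rewrite subSS (subKn (ltn_ord k : k <= n)%N).
  apply: (le_trans (sum_geometric_le _ _)); first by rewrite x0.
  (* This replaces the sum [(1 - x)^-1] of the series by the explicit [1 + (th * r)^-1]. *)
  have le_x : x <= (1 + th * r)^-1.
    by rewrite /x expRN lef_pV2 ?posrE ?expR_gt0 ?addr_gt0// expR_ge1Dx.
  have -> : 1 + (th * r)^-1 = (1 - (1 + th * r)^-1)^-1 by field; lra.
  rewrite lef_pV2 ?posrE ?subr_gt0//; first by rewrite lerD2l lerN2.
  by rewrite invf_lt1 ?ltrDl// addr_gt0.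
move=> w /not_orP[/not_orP[nout nearly] nlates]; split.
- have : ~ ~ (U w \in `[0, 1]) by move=> /nout.
  by move=> /contrapT; rewrite in_itv.
- exact/early_boundP/not_exceeds.
move=> k kn; apply/late_boundP/not_exceeds => latek; apply: nlates.
by rewrite /lates -bigcup_mkord; exists k.
Qed.

(** The candidate times [n - m * b] are [m] apart, so the blocks of [m] customers just before them
    are disjoint, and [m * B <= n] keeps these times nonnegative. [second_moment] selects one of
    them; Markov's inequality controls the late customers at time [n]. *)
Lemma good_event_lower (n m B : nat) (M L mu nu : R) :
    (m * B <= n)%N -> (0 < B)%N -> 0 < M -> 0 < L ->
    let q := \prod_(j < m) tail j.+1%:R in
    0 < q ->
    (forall k m, \sum_(j < m) pr (early_event xi k j) <= mu) ->
    (forall m, \sum_(j < m) tail (j%:R - 2) <= nu) ->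
  exists D, [/\ measurable D,
    pr D <= 4 / (B%:R * q) + 2 * mu / M + nu / L &
    forall w, ~ D w -> late_bound xi n L w /\ exists2 b, (b < B)%N &
      early_bound xi (n - m * b)%N M w /\
      (forall j, (j < m)%N -> j.+1%:R < xi ((n - m * b)%N%:Z - j.+1%:Z) w)].
Proof.
move=> mB B0 M0 L0 q q0 le_mu le_nu.
(* [A b] says that the [m] customers scheduled just before time [n - m * b] are
   all late at that time. The threshold of customer [n - 1 - u] depends on [u]
   alone, so the events of two blocks belong to one independent family. *)
pose lev (u : nat) : set R := [set` `](u %% m).+1%:R : R, +oo[].
pose A b := \bigcap_(u in [set` iota (m * b) m]) xi (n%:Z - 1 - u%:Z) @^-1` lev u.
have mA b : measurable (A b).
  apply: fin_bigcap_measurable => // u _.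
  by apply: measurable_preim; exact: measurable_itv.
pose E (b : nat) j := early_event xi (n - m * b)%N j.
have mE b j : measurable (E b j) by exact: measurable_early_event.
have phi_inj (s : seq nat) : {in s &, injective (fun u : nat => n%:Z - 1 - u%:Z)}.
  by move=> u v _ _; lia.
have prod_lev b : \prod_(u <- iota (m * b) m) pr (xi (n%:Z - 1 - u%:Z) @^-1` lev u) = q.
  rewrite -[X in iota X]addn0 iotaDl big_map -[X in iota _ X]subn0 -/(index_iota 0 m).
  rewrite big_mkord; apply: eq_bigr => j _.
  by rewrite pr_xi// /lev mulnC modnMDl modn_small.
have prA b : (b < B)%N -> pr (A b) = q.
  move=> _; rewrite -(prod_lev b); apply: pr_bigcap_xi => //; first exact: iota_uniq.
  by move=> u; exact: measurable_itv.
have prAA b b' : (b < B)%N -> (b' < B)%N -> b != b' -> pr (A b `&` A b') = q ^+ 2.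
  move=> _ _ bb'; pose s := iota (m * b) m ++ iota (m * b') m.
  have us : uniq s.
    rewrite cat_uniq !iota_uniq andbT/=; apply/hasPn => u.
    by rewrite !mem_iota; move: bb'; rewrite neq_ltn; nia.
  have -> : A b `&` A b' =
      \bigcap_(u in [set` s]) xi (n%:Z - 1 - u%:Z) @^-1` lev u.
    apply/seteqP; split => w.
      move=> [Ab Ab'] u us'; have : u \in s by [].
      by rewrite mem_cat => /orP[ub|ub]; [exact: Ab|exact: Ab'].
    by move=> As; split => u ub; apply: As; rewrite /= mem_cat; apply/orP; [left|right].
  rewrite expr2 -{1}(prod_lev b) -(prod_lev b') -big_cat; apply: pr_bigcap_xi => // u.
  exact: measurable_itv.
pose e j := pr (early_event xi 0 j).
(* [None] stands for the customer that may be early at time [n - m * b]. *)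
have prAE b j : (b < B)%N -> pr (A b `&` E b j) = q * e j.
  move=> bB; pose phi o := if o is Some u then n%:Z - 1 - u%:Z
    else (n - m * b)%N%:Z + j%:Z.
  pose F o := if o is Some u then lev u else `]-oo, - j%:R]%classic : set R.
  pose s := None :: map Some (iota (m * b) m).
  have us : uniq s.
    rewrite /= (map_inj_uniq Some_inj) iota_uniq andbT.
    by apply/negP => /seq.mapP[].
  have mbn : (m * b <= n)%N by apply: leq_trans mB; rewrite leq_mul2l (ltnW bB) orbT.
  have -> : A b `&` E b j = \bigcap_(o in [set` s]) xi (phi o) @^-1` F o.
    apply/seteqP; split => w.
      move=> [Ab Eb] [u|] us' //; apply: Ab.
      have : Some u \in s by [].
      by rewrite inE/= (mem_map Some_inj).
    move=> As; split => [u ub|].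
      apply: (As (Some u)); have : Some u \in s by rewrite inE/= (mem_map Some_inj).
      by [].
    by apply: (As None); have : None \in s by rewrite inE.
  rewrite (pr_bigcap_xi xi_indep us)//; last 2 first.
  - move=> o o' os os'.
    (* Customers of the block have numbers below [n - m * b] and the possibly early one does not, so
       [phi] is injective on [s]. *)
    have lt_u u : Some u \in s -> (m * b <= u)%N.
      by rewrite inE/= (mem_map Some_inj) mem_iota => /andP[].
    case: o os => [u|] os; case: o' os' => [v|] os'; rewrite /phi// => uv.
    + by congr Some; lia.
    + by exfalso; have := lt_u _ os; lia.
    + by exfalso; have := lt_u _ os'; lia.
  - by case=> [u|]; [exact: measurable_itv|exact: measurable_itv].
  rewrite big_cons big_map/= prod_lev mulrC; congr (_ * _).
  by transitivity (pr (xi 0 @^-1` `]-oo, - (j%:R : R)])); [|symmetry];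
    apply: (pr_xi xi_ident); exact: measurable_itv.
have [D [mD le_D goodD]] := second_moment mA mE B0 q0 M0 prA prAA prAE (le_mu 0).
pose late := exceeds (late_event xi n) L.
have mlate : measurable late.
  by apply: measurable_exceeds; exact: measurable_late_event.
exists (D `|` late); split; first exact: measurableU.
  apply: (le_trans (pr_setU _ _ _)) => //; apply: lerD => //.
  apply: markov_exceeds => // m'; first exact: measurable_late_event.
  by under eq_bigr do rewrite pr_late_event//.
move=> w /not_orP[nD nlate]; split; first exact/late_boundP/not_exceeds.
have [b bB [Ab Eb]] := goodD w nD; exists b => //; split; first exact/early_boundP.
move=> j jm.
have mbn : (m * b <= n)%N by apply: leq_trans mB; rewrite leq_mul2l (ltnW bB) orbT.
have mem_j : (m * b + j)%N \in iota (m * b) m by rewrite mem_iota; lia.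
have mod_j : ((m * b + j) %% m = j)%N by rewrite mulnC modnMDl modn_small.
have {Ab mem_j} := Ab _ mem_j; rewrite /lev/= in_itv/= andbT mod_j.
by have -> : n%:Z - 1 - (m * b + j)%N%:Z = (n - m * b)%N%:Z - j.+1%:Z by lia.
Qed.

End workload_probabilities.

(** * Asymptotics in [K = ln (1 / (1 - rho))] *)

Section asymptotics.
Context (R : realType).
Implicit Types (K A : R).

(** With [l = ln K], [K] is the square of [expR (l / 2)], hence at least [(1 + l / 2) ^+ 2], which
    exceeds [A * l] once [l >= 4 * A]. *)
Lemma div_ln_large A :
  exists K0, forall K, K0 <= K -> [/\ 1 <= ln K, A <= ln K, A <= K / ln K & 0 < K].
Proof.
pose B : R := Num.max 1 (Num.max A (4 * A)).
have B1 : 1 <= B by rewrite le_max lexx.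
have BA : A <= B by rewrite !le_max lexx orbT.
have B4A : 4 * A <= B by rewrite !le_max lexx !orbT.
exists (expR B) => K BK.
have K0 : 0 < K by rewrite (lt_le_trans (expR_gt0 B)).
have lnB : B <= ln K by rewrite -[leLHS]expRK ler_ln ?posrE ?expR_gt0.
have ln1 : 1 <= ln K by exact: le_trans lnB.
split => //; first exact: le_trans lnB.
rewrite ler_pdivlMr; last lra.
rewrite [leRHS](_ : K = expR (ln K / 2) ^+ 2); last by rewrite -expRM_natr divfK// lnK.
have := expR_ge1Dx (ln K / 2).
set l := ln _ in lnB ln1 *; set e := expR _ => le_e.
have : (1 + l / 2) ^+ 2 <= e ^+ 2 by rewrite ler_sqr ?nnegrE//; lra.
have : 0 <= (l - 4 * A) * l by rewrite mulr_ge0; lra.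
by lra.
Qed.

(** The roles of the inequalities: [1 < alpha * b] makes the powers of the tail summable,
    [a * b < 1] makes the Laplace exponent [o(K)], and [1 < a * (alpha^-1 + eta)] lets Chernoff's
    exponent beat the [expR K] relevant times. So [a] is taken close to [alpha], and [b] between
    [alpha^-1] and [a^-1]. *)
Lemma upper_exponents (alpha eta : R) : 1 < alpha -> 0 < eta ->
  exists a b, [/\ 1 < a, 0 < b, b <= 1, 1 < alpha * b & a * b < 1 /\ 1 < a * (alpha^-1 + eta)].
Proof.
move=> alpha1 eta0; have alpha0 : 0 < alpha by lra.
have alphaV0 : 0 < alpha^-1 by rewrite invr_gt0.
pose s := alpha^-1 + eta; have s0 : 0 < s by rewrite addr_gt0.
pose a0 := Num.max 1 s^-1.
have a0alpha : a0 < alpha.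
  rewrite gt_max alpha1/= -[ltRHS]invrK ltf_pV2 ?posrE//.
  by rewrite ltrDl.
have [a a0a aalpha] : exists2 a, a0 < a & a < alpha.
  by exists ((a0 + alpha) / 2); lra.
move: (a0a); rewrite gt_max => /andP[a1 sa].
have a_gt0 : 0 < a by lra.
have aV1 : a^-1 < 1 by rewrite invf_lt1.
have aalphaV : alpha^-1 < a^-1 by rewrite ltf_pV2 ?posrE.
have [b ba balpha] : exists2 b, b < a^-1 & alpha^-1 < b.
  by exists ((a^-1 + alpha^-1) / 2); lra.
exists a, b; split => //; [lra|lra| |split].
- by rewrite mulrC -ltr_pdivrMr// mul1r.
- by rewrite mulrC -ltr_pdivlMr// mul1r.
- by rewrite -ltr_pdivrMr// mul1r.
Qed.

(** Chernoff's exponent is [- (1 + 2 * kap) * K]. The Laplace transform gives back at most [kap * K]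
    and the prefactor is at most [2 * expR K], which leaves [2 * expR (- (kap * K))]. *)
Lemma upper_error_small (alpha eta a b C mu ep : R) :
    1 < alpha -> 0 < eta -> 0 < ep -> 1 < a -> 0 < b -> a * b < 1 ->
    1 < a * (alpha^-1 + eta) ->
  exists K0, forall K, K0 <= K -> forall r, expR (- K) <= r ->
    mu / (eta * (K / ln K)) +
      (1 + (a * ln K * r)^-1) *
      expR (- (a * ln K * ((alpha^-1 + eta) * (K / ln K))) +
            b^-1 * (expR (a * ln K * b) * C)) <= ep.
Proof.
move=> alpha1 eta0 ep0 a1 b0 ab1 as1.
pose kap := (a * (alpha^-1 + eta) - 1) / 2.
have kap0 : 0 < kap by rewrite /kap; lra.
have kapE : a * (alpha^-1 + eta) = 1 + 2 * kap by rewrite /kap; lra.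
clearbody kap.
pose A := Num.max (2 * mu / (eta * ep)) (Num.max (b^-1 * C / (kap * (1 - a * b)))
  (Num.max (4 / (ep * kap)) 1)).
have [K0 K0P] := div_ln_large A.
exists K0 => K K0K r Kr.
have [ln1 lnA xA Kgt0] := K0P K K0K.
set l := ln K in ln1 lnA xA *; set x := K / l in xA *.
have l0 : 0 < l by lra.
move: lnA; rewrite /A !ge_max => /and4P[_ lnA _ _].
move: xA; rewrite /A !ge_max => /and4P[xmu _ xep x1].
have r0 : 0 < r by rewrite (lt_le_trans (expR_gt0 (- K))).
have al1 : 1 <= a * l by nra.
have alr0 : 0 < a * l * r by rewrite !mulr_gt0//; lra.
have xl : x * l = K by rewrite /x divfK// gt_eqF.
have first_le : mu / (eta * x) <= ep / 2.
  have ex0 : 0 < eta * x by rewrite mulr_gt0//; lra.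
  rewrite ler_pdivrMr//.
  move: xmu; rewrite ler_pdivrMr ?mulr_gt0//; lra.
have pre_le : 1 + (a * l * r)^-1 <= 2 * expR K.
  have e1 : 1 <= expR K by rewrite -[leLHS]expR0 ler_expR ltW.
  suff : (a * l * r)^-1 <= expR K by lra.
  rewrite -[leRHS]invrK lef_pV2 ?posrE ?invr_gt0 ?expR_gt0// -expRN.
  apply: (le_trans Kr); rewrite -[leLHS]mul1r ler_pM2r//.
have exp_le : - (a * l * ((alpha^-1 + eta) * x)) + b^-1 * (expR (a * l * b) * C) <=
    - K - kap * K.
  have -> : a * l * ((alpha^-1 + eta) * x) = (1 + 2 * kap) * K.
    rewrite -xl -kapE; ring.
  suff : b^-1 * (expR (a * l * b) * C) <= kap * K by lra.
  have lnA' : b^-1 * C <= kap * expR ((1 - a * b) * l).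
    have ab0 : 0 < 1 - a * b by lra.
    move: lnA; rewrite ler_pdivrMr ?mulr_gt0// => lnA.
    have := expR_ge1Dx ((1 - a * b) * l) => e1.
    have : (1 - a * b) * l <= expR ((1 - a * b) * l) by lra.
    rewrite -(ler_pM2l kap0) => e2; apply: (le_trans lnA).
    by apply: le_trans e2; lra.
  (* This writes [K] as the product of its powers [1 - a * b] and [a * b]: the second is the growth
     of the Laplace exponent, the first absorbs the constants. *)
  have KE : K = expR ((1 - a * b) * l) * expR (a * l * b).
    by rewrite -expRD -[LHS]lnK ?posrE//; congr expR; rewrite -/l; ring.
  have -> : b^-1 * (expR (a * l * b) * C) = b^-1 * C * expR (a * l * b) by ring.
  have -> : kap * K = kap * expR ((1 - a * b) * l) * expR (a * l * b).
    by rewrite -mulrA -KE.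
  by rewrite ler_pM2r ?expR_gt0.
have second_le : (1 + (a * l * r)^-1) *
    expR (- (a * l * ((alpha^-1 + eta) * x)) + b^-1 * (expR (a * l * b) * C)) <= ep / 2.
  apply: (@le_trans _ _ (2 * expR K * expR (- K - kap * K))).
    apply: ler_pM => //; last by rewrite ler_expR.
    by rewrite addr_ge0// invr_ge0 ltW.
  rewrite -mulrA -expRD (_ : K + (- K - kap * K) = - (kap * K)); last ring.
  rewrite expRN ler_pdivrMr ?expR_gt0//.
  have : 4 / ep <= kap * K.
    have xK : x <= K by rewrite -xl ler_peMr//; lra.
    rewrite -ler_pdivrMl// mulrC -mulrA -invfM.
    exact: le_trans xK.
  rewrite ler_pdivrMr// => kK.
  by have := expR_ge1Dx (kap * K); nra.
lra.
Qed.

(** For this [m] the exponent in the bound on [q] is at most [(1 - alpha * eta / 4) * K], so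
    [B%:R * q] grows at least like [expR (alpha * eta / 4 * K)]. The factor [delta] keeps the drift
    over all [B] blocks below [eta / 16 * x]. *)
Lemma lower_error_small (alpha eta lam mu nu ep : R) :
    1 < alpha -> 0 < eta -> eta < alpha^-1 -> 0 <= lam -> 0 < ep ->
    let delta := eta * alpha / 32 in
  exists K0, forall K, K0 <= K -> let x := K / ln K in
    let m := Num.truncn ((alpha^-1 - eta / 2) * x) in
    let B := Num.truncn (delta * expR K) in
    [/\ (0 < B)%N, m%:R <= K, 0 < x, 3 <= eta / 4 * x &
      forall q, expR (- (m%:R * (lam + alpha * ln K))) <= q ->
        4 / (B%:R * q) + 2 * mu / (eta / 16 * x) + nu / (eta / 16 * x) <= ep].
Proof.
move=> alpha1 eta0 eta_lt lam0 ep0 delta.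
have alpha0 : 0 < alpha by lra.
have alphaV0 : 0 < alpha^-1 by rewrite invr_gt0.
have delta0 : 0 < delta by rewrite /delta !mulr_gt0.
have alphaV1 : alpha^-1 < 1 by rewrite invf_lt1.
have ae0 : 0 < alpha * eta by rewrite mulr_gt0.
pose A := Num.max (2 / delta) (Num.max (lam * alpha^-1 / (alpha * eta / 4))
  (Num.max (128 / (alpha * eta * delta * ep)) (Num.max (12 / eta)
  (Num.max (64 * mu / (eta * ep)) (Num.max (64 * nu / (eta * ep)) 1))))).
have [K0 K0P] := div_ln_large A.
exists K0 => K K0K x m B.
have [ln1 lnA xA Kgt0] := K0P K K0K.
set l := ln K in ln1 lnA x xA m *; rewrite -/x in xA.
have l0 : 0 < l by lra.
move: lnA; rewrite /A !ge_max => /and3P[_ lnlam _].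
move: xA; rewrite /A !ge_max => /and5P[xdelta _ xep xeta /and3P[xmu xnu x1]].
have x0 : 0 < x by lra.
have xl : x * l = K by rewrite /x divfK// gt_eqF.
have xK : x <= K by rewrite -xl ler_peMr//; lra.
have eK : K <= expR K by have := expR_ge1Dx K; lra.
have m_le : m%:R <= (alpha^-1 - eta / 2) * x.
  by rewrite truncn_le mulr_ge0; lra.
have dK : 2 <= delta * expR K.
  by move: xdelta; rewrite ler_pdivrMr// => h; nra.
have B_ge : delta * expR K / 2 <= B%:R.
  have := truncnS_gt (delta * expR K); rewrite -/B -natr1; lra.
split => //.
- by rewrite -(ltr_nat R); lra.
- by apply: (le_trans m_le); nra.
- by move: xeta; rewrite ler_pdivrMr//; lra.
move=> q q_ge.
have BX : 64 / (4 * ep) <= B%:R * q.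
  have mlam : m%:R * (lam + alpha * l) <= (1 - alpha * eta / 4) * K.
    apply: (@le_trans _ _ ((alpha^-1 - eta / 2) * x * (lam + alpha * l))).
      by rewrite ler_wpM2r// addr_ge0// ltW// mulr_gt0.
    have -> : (alpha^-1 - eta / 2) * x * (lam + alpha * l) =
        (1 - alpha * eta / 2) * K + (alpha^-1 - eta / 2) * lam * x.
      by rewrite -xl; field; lra.
    suff : (alpha^-1 - eta / 2) * lam * x <= alpha * eta / 4 * K by lra.
    apply: (@le_trans _ _ (lam * alpha^-1 * x)).
      by rewrite ler_pM2r//; nra.
    have -> : alpha * eta / 4 * K = l * (alpha * eta / 4) * x by rewrite -xl; ring.
    by rewrite ler_pM2r// -ler_pdivrMr// divr_gt0.
  have q0 : 0 < q by rewrite (lt_le_trans (expR_gt0 _) q_ge).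
  apply: (@le_trans _ _ (delta * expR K / 2 * expR (- ((1 - alpha * eta / 4) * K)))).
    have -> : delta * expR K / 2 * expR (- ((1 - alpha * eta / 4) * K)) =
        delta / 2 * expR (alpha * eta / 4 * K).
      have -> : delta * expR K / 2 * expR (- ((1 - alpha * eta / 4) * K)) =
        delta / 2 * (expR K * expR (- ((1 - alpha * eta / 4) * K))) by ring.
      by rewrite -expRD; congr (_ * expR _); ring.
    have e1 := expR_ge1Dx (alpha * eta / 4 * K).
    move: xep; rewrite ler_pdivrMr ?mulr_gt0// => xep.
    rewrite ler_pdivrMr ?mulr_gt0//.
    have h1 : 128 <= K * (alpha * eta * delta * ep).
      by apply: (le_trans xep); rewrite ler_pM2r// ?mulr_gt0.
    have h2 : delta / 2 * (alpha * eta / 4 * K) * (4 * ep) <=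
        delta / 2 * expR (alpha * eta / 4 * K) * (4 * ep).
      by rewrite ler_pM2r ?mulr_gt0// ler_pM2l ?divr_gt0//; lra.
    by lra.
  apply: (ler_pM _ (expR_ge0 _) B_ge); first by lra.
  by apply: le_trans q_ge; rewrite ler_expR lerN2.
have t1 : 4 / (B%:R * q) <= ep / 4.
  have Bq0 : 0 < B%:R * q by apply: lt_le_trans BX; rewrite divr_gt0// mulr_gt0.
  rewrite ler_pdivrMr//; move: BX; rewrite ler_pdivrMr ?mulr_gt0//; lra.
have ex0 : 0 < eta / 16 * x by rewrite mulr_gt0// divr_gt0.
have t2 : 2 * mu / (eta / 16 * x) <= ep / 2.
  by rewrite ler_pdivrMr//; move: xmu; rewrite ler_pdivrMr ?mulr_gt0//; lra.
have t3 : nu / (eta / 16 * x) <= ep / 4.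
  by rewrite ler_pdivrMr//; move: xnu; rewrite ler_pdivrMr ?mulr_gt0//; lra.
lra.
Qed.

(** Budget for the loss [eta * x]: [eta / 2 * x] from the choice of [m], at most [eta / 4 * x] for
    rounding and the constant [2], and [eta / 16 * x] each for early customers, late customers and
    drift. *)
Lemma lower_main_term (alpha eta x E r : R) (b : nat) :
    0 < alpha -> 0 < eta -> eta < alpha^-1 -> 0 < x -> 3 <= eta / 4 * x ->
    0 < E -> 0 <= r -> r * E <= 2 ->
    let m := Num.truncn ((alpha^-1 - eta / 2) * x) in
    (b <= Num.truncn (eta * alpha / 32 * E))%N ->
  (alpha^-1 - eta) * x <=
    m%:R - eta / 16 * x - eta / 16 * x - 2 - r * (m * b)%:R.
Proof.
move=> alpha0 eta0 eta_lt x0 x_large E0 r0 rE m b_le.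
have m_gt : (alpha^-1 - eta / 2) * x < m%:R + 1 by rewrite natr1; exact: truncnS_gt.
have m_le : m%:R <= alpha^-1 * x.
  have coef0 : 0 <= alpha^-1 - eta / 2 by lra.
  apply: (@le_trans _ _ ((alpha^-1 - eta / 2) * x)).
    by rewrite truncn_le mulr_ge0// ltW.
  by rewrite ler_pM2r//; lra.
have rb : r * b%:R <= eta * alpha / 16.
  have d0 : 0 <= eta * alpha / 32 by rewrite divr_ge0// mulr_ge0// ltW.
  apply: (@le_trans _ _ (r * (eta * alpha / 32 * E))).
    rewrite ler_wpM2l//; apply: (@le_trans _ _ (Num.truncn (eta * alpha / 32 * E))%:R).
      by rewrite ler_nat.
    by rewrite truncn_le mulr_ge0// ltW.
  have -> : r * (eta * alpha / 32 * E) = eta * alpha / 32 * (r * E) by ring.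
  by apply: (le_trans (ler_wpM2l d0 rE)); lra.
have drift : r * (m * b)%:R <= eta / 16 * x.
  rewrite natrM mulrCA.
  have -> : eta / 16 * x = alpha^-1 * x * (eta * alpha / 16).
    by field; rewrite gt_eqF.
  by rewrite ler_pM// mulr_ge0.
by lra.
Qed.

End asymptotics.

(** * Passage to the limit law *)

Section limit_laws.
Context (R : realType).

(* Nothing is assumed measurable: this is applied to the workload, a supremum
   over uncountably many times. *)
Lemma le_integral_nonneg d (T : measurableType d) (mu : {measure set T -> \bar R})
    (f g : T -> \bar R) :
  (forall w, 0 <= f w)%E -> (forall w, f w <= g w)%E ->
  (\int[mu]_w f w <= \int[mu]_w g w)%E.
Proof.
move=> f0 fg; rewrite !ge0_integralTE//; last by move=> w; exact: le_trans (fg w).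
apply: le_ereal_sup => _ [h /= hf <-]; exists h => // w.
exact: le_trans (fg w).
Qed.

Lemma has_mean_bounded d (T : measurableType d) (P : probability T R)
    (g : T -> R) (M : R) :
  measurable_fun setT g -> (forall w, `|g w| <= M) ->
  has_mean P g (fine (\int[P]_w (g w)%:E)).
Proof.
move=> mg gM.
have intg : P.-integrable setT (EFin \o g).
  have intM : P.-integrable setT (EFin \o cst M).
    by have [] := has_mean_cst P M.
  apply: (le_integrable measurableT _ _ intM); first exact/measurable_EFinP.
  by move=> w _; rewrite /= lee_fin (le_trans (gM w))// ler_norm.
by split=> //; rewrite fineK//; exact: integrable_fin_num.
Qed.

(** The test function [f] gives [pr Q S <= E f(Y) = lim E f(W n) <= ep]. Integer times suffice, as
    the limit along all times is given. *)
Lemma limit_pr_le d (T : measurableType d) (P : probability T R)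
    (W : R -> T -> R) d' (T' : measurableType d') (Q : probability T' R)
    (Y : T' -> R) (f : R -> R) (N : nat) (ep : R) (S : set T') :
    cvg_in_distribution (+oo : set_system R) (fun=> P) W Q Y ->
    continuous f -> (forall u, 0 <= f u <= 1) ->
    (forall n, (N <= n)%N -> exists D, [/\ measurable D, pr P D <= ep &
       forall w, ~ D w -> f (W n%:R w) = 0]) ->
    measurable S -> (forall w, S w -> f (Y w) = 1) ->
  pr Q S <= ep.
Proof.
move=> cvgW fcont f01 small mS fS.
have fbnd : bounded_fun f.
  exists 1; split => // x x1 u _ /=; have /andP[f0 f1] := f01 u.
  by rewrite ger0_norm// (le_trans f1)// ltW.
have cvgn : ('E_P[f \o W n%:R] @[n --> \oo] --> 'E_Q[f \o Y])%E.
  exact: (cvg_comp _ _ cvgr_idn (cvgW f fcont fbnd)).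
have f_ge0 u : (0 <= (f u)%:E)%E by rewrite lee_fin; have /andP[] := f01 u.
rewrite -lee_fin -prE//.
apply: (@le_trans _ _ 'E_Q[f \o Y]%E).
  rewrite unlock -[S]setIT -integral_indic//; apply: le_integral_nonneg => w.
    by rewrite lee_fin indicE.
  rewrite lee_fin indicE; case: (boolP (w \in S)) => [/set_mem/fS|_]; first by move=> /= ->.
  by have /andP[] := f01 (Y w).
rewrite -(cvg_lim _ cvgn)//; apply: lime_le; first by apply/cvg_ex; eexists; exact: cvgn.
near=> n.
have [D [mD Dep fD]] : exists D, [/\ measurable D, pr P D <= ep &
    forall w, ~ D w -> f (W n%:R w) = 0].
  by apply: small; near: n; exact: nbhs_infty_ge.
apply: (@le_trans _ _ (P D)); last by rewrite prE// lee_fin.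
rewrite unlock -[D]setIT -integral_indic//; apply: le_integral_nonneg => w; first exact: f_ge0.
rewrite lee_fin indicE; case: (boolP (w \in D)) => [_|/negP].
  by have /andP[] := f01 (W n%:R w).
by rewrite inE => /fD /= ->.
Unshelve. all: by end_near. Qed.

(** The identity clipped to [[0, 1]], written with absolute values so that continuity is
    immediate. *)
Definition ramp (u : R) : R := (1 + `|u| - `|1 - u|) / 2.

Lemma ramp01 u : 0 <= ramp u <= 1.
Proof.
by rewrite /ramp; case: (ger0P u); case: (ger0P (1 - u)); lra.
Qed.

Lemma ramp_eq0 u : u <= 0 -> ramp u = 0.
Proof. by move=> u0; rewrite /ramp ler0_norm// ger0_norm; lra. Qed.

Lemma ramp_eq1 u : 1 <= u -> ramp u = 1.
Proof. by move=> u1; rewrite /ramp ger0_norm ?ler0_norm; lra. Qed.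

Lemma continuous_ramp : continuous ramp.
Proof.
move=> u; apply: cvgM; last exact: cvg_cst.
apply: cvgB.
  by apply: cvgD; [exact: cvg_cst|apply: cvg_norm; exact: cvg_id].
by apply: cvg_norm; apply: cvgB; [exact: cvg_cst|exact: cvg_id].
Qed.

Section tails.
Context d (T : measurableType d) (P : probability T R) (W : R -> T -> R)
  d' (T' : measurableType d') (Q : probability T' R) (Y : {RV Q >-> R}).
Hypothesis cvgW : cvg_in_distribution (+oo : set_system R) (fun=> P) W Q Y.

(** The gap between [x] and [x + 1] is the width of the ramp; it vanishes after scaling. *)
Lemma limit_upper_tail (x ep : R) :
    (forall n : nat, exists D, [/\ measurable D, pr P D <= ep &
       forall w, ~ D w -> W n%:R w <= x]) ->
  pr Q [set w | x + 1 <= Y w] <= ep.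
Proof.
move=> small; apply: (@limit_pr_le _ _ _ _ _ _ _ _ (fun u => ramp (u - x)) 0 _ _ cvgW).
- move=> u; apply: (@continuous_comp _ _ _ (fun u => u - x) ramp);
    last exact: continuous_ramp.
  by apply: cvgB; [exact: cvg_id|exact: cvg_cst].
- by move=> u; exact: ramp01.
- move=> n _; have [D [mD Dep DW]] := small n; exists D; split => // w /DW Wx.
  by rewrite ramp_eq0// subr_le0.
- have := measurable_preim Y (measurable_itv `[x + 1, +oo[).
  set S := (X in measurable X -> _); suff -> : [set w | x + 1 <= Y w] = S by [].
  by rewrite /S; apply/seteqP; split => w /=; rewrite in_itv/= andbT.
- by move=> w /= xY; rewrite ramp_eq1//; lra.
Qed.

Lemma limit_lower_tail (x ep : R) (N : nat) :
    (forall n : nat, (N <= n)%N -> exists D, [/\ measurable D, pr P D <= ep &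
       forall w, ~ D w -> x <= W n%:R w]) ->
  pr Q [set w | Y w <= x - 1] <= ep.
Proof.
move=> small; apply: (@limit_pr_le _ _ _ _ _ _ _ _ (fun u => ramp (x - u)) N _ _ cvgW).
- move=> u; apply: (@continuous_comp _ _ _ (fun u => x - u) ramp);
    last exact: continuous_ramp.
  by apply: cvgB; [exact: cvg_cst|exact: cvg_id].
- by move=> u; exact: ramp01.
- move=> n Nn; have [D [mD Dep DW]] := small n Nn; exists D; split => // w /DW Wx.
  by rewrite ramp_eq0// subr_le0.
- have := measurable_preim Y (measurable_itv `]-oo, x - 1]).
  set S := (X in measurable X -> _); suff -> : [set w | Y w <= x - 1] = S by [].
  by rewrite /S; apply/seteqP; split => w /=; rewrite in_itv.
- by move=> w /= xY; rewrite ramp_eq1//; lra.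
Qed.

End tails.

(** Off [D], [f (X r w)] is within [e / 2] of [f l] by continuity; on [D] the difference is at most
    [2 * M], and [D] has probability at most [e / (4 * M)]. *)
Lemma cvg_in_distribution_cst (F : set_system R) {FF : Filter F}
    (d' : R -> measure_display) (T' : forall r, measurableType (d' r))
    (Q : forall r, probability (T' r) R) (X : forall r, T' r -> R)
    d (T : measurableType d) (P : probability T R) (l : R) :
    (forall r, measurable_fun setT (X r)) ->
    (forall eta ep : R, 0 < eta -> 0 < ep -> \forall r \near F,
       exists D, [/\ measurable D, pr (Q r) D <= ep &
         forall w, ~ D w -> `|X r w - l| <= eta]) ->
  cvg_in_distribution F Q X P (cst l).
Proof.
move=> mX Xl f fcont [M0 [_ fM]].
pose M := Num.max 1 (M0 + 1).
have M1 : 1 <= M by rewrite le_max lexx.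
have {}fM u : `|f u| <= M.
  by apply: (fM M) => //; rewrite lt_max ltrDl ltr01 orbT.
have mf r : measurable_fun setT (f \o X r).
  by apply: measurableT_comp => //; exact: continuous_measurable_fun.
pose v r := fine (\int[Q r]_w ((f \o X r) w)%:E).
have meanf r : has_mean (Q r) (f \o X r) (v r).
  by apply: (@has_mean_bounded _ _ (Q r) _ M) => // w; exact: fM.
have -> : (fun r => 'E_(Q r)[f \o X r]%E) = EFin \o v.
  by apply/funext => r; rewrite unlock; exact: (meanf r).2.
have -> : 'E_P[f \o cst l]%E = (f l)%:E by rewrite (_ : f \o cst l = cst (f l))// expectation_cst.
apply: cvg_EFin; first by near=> r.
apply/cvgrPdist_le => e e0.
have e20 : 0 < e / 2 by rewrite divr_gt0.
have /cvgrPdist_le/(_ _ e20) := fcont l.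
move=> /nbhs_ballP[eta /= eta0 f_near].
have eta20 : 0 < eta / 2 by rewrite divr_gt0.
have ep0 : 0 < e / (4 * M) by rewrite divr_gt0// mulr_gt0//; lra.
near=> r.
have [D [mD Dep XD]] : exists D, [/\ measurable D, pr (Q r) D <= e / (4 * M) &
    forall w, ~ D w -> `|X r w - l| <= eta / 2].
  by near: r; exact: Xl.
have close w : `|f l - f (X r w)| <= e / 2 + 2 * M * \1_D w.
  rewrite indicE; case: (boolP (w \in D)) => [_|/negP].
    rewrite mulr1 (le_trans (ler_normB _ _))//.
    by have := fM l; have := fM (X r w); lra.
  rewrite inE => /XD Xw; rewrite mulr0 addr0; apply: f_near.
  by rewrite /ball/= distrC (le_lt_trans Xw)//; lra.
have meanD := has_meanD (has_mean_cst (Q r) (e / 2))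
  (has_meanZ (2 * M) (has_mean_indic (Q r) mD)).
have meanB := has_meanD (has_mean_cst (Q r) (f l)) (has_meanZ (-1) (meanf r)).
have meanN := has_meanD (has_mean_cst (Q r) (- f l)) (meanf r).
have le1 : f l + -1 * v r <= e / 2 + 2 * M * pr (Q r) D.
  apply: (has_mean_le meanB meanD) => w /=.
  by rewrite mulN1r (le_trans _ (close w))// ler_norm.
have le2 : - f l + v r <= e / 2 + 2 * M * pr (Q r) D.
  apply: (has_mean_le meanN meanD) => w /=.
  by rewrite (le_trans _ (close w))// -normrN opprB addrC ler_norm.
have : 2 * M * pr (Q r) D <= e / 2.
  move: Dep; rewrite ler_pdivlMr ?mulr_gt0//; first by lra.
  by lra.
by rewrite ler_norml; lra.
Unshelve. all: by end_near. Qed.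

End limit_laws.

(** * The workload in heavy traffic *)

Section eventual_bounds.
Context (R : realType) (d : measure_display) (T : measurableType d)
  (P : probability T R) (xi : int -> {RV P >-> R}) (U : {RV P >-> R})
  (c alpha : R).
Hypotheses (xi_indep : mutually_independent xi)
  (xi_ident : identically_distributed xi) (U_unif : uniform01 U)
  (xi_neg_mean : ('E_P[(fun w => Num.max (- xi 0 w) 0)%R] < +oo)%E)
  (c_gt0 : 0 < c) (alpha_gt1 : 1 < alpha)
  (xi_tail : fine (ccdf (xi 0) x) / (c * x `^ (- alpha)) @[x --> +oo] --> (1 : R)).

Local Notation tail := (tail xi).

Let alpha_gt0 : 0 < alpha. Proof. exact: lt_trans alpha_gt1. Qed.

Lemma tail_regular : exists2 x0, 0 < x0 & forall x : R, x0 <= x ->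
  c / 2 * x `^ (- alpha) <= tail x <= 2 * c * x `^ (- alpha).
Proof.
have half0 : 0 < 1 / 2 :> R by lra.
move/cvgrPdist_le : xi_tail => /(_ _ half0)[M [_ tailM]].
exists (Num.max 1 (M + 1)) => [|x]; first by rewrite lt_max ltr01.
rewrite ge_max => /andP[x1 Mx].
have x0 : 0 < x by lra.
have p0 : 0 < c * x `^ (- alpha) by rewrite mulr_gt0// powR_gt0.
have le_half : `|1 - tail x / (c * x `^ (- alpha))| <= 1 / 2 by apply: tailM; lra.
have -> : tail x = tail x / (c * x `^ (- alpha)) * (c * x `^ (- alpha)).
  by rewrite divfK// gt_eqF.
move: le_half p0; set p := c * _; set t := tail x / p.
rewrite ler_norml => /andP[h1 h2] p0.
have -> : c / 2 * x `^ (- alpha) = 1 / 2 * p by rewrite /p; ring.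
have -> : 2 * c * x `^ (- alpha) = 2 * p by rewrite /p; ring.
by rewrite !ler_pM2r//; lra.
Qed.

(** The lower bound of block probabilities involves all thresholds from [1] on. Below [x0] the tail
    is at least [tail x0 > 0] and the power is at most [1]. *)
Lemma tail_ge_powR : exists2 c', 0 < c' <= 1 &
  forall x : R, 1 <= x -> c' * x `^ (- alpha) <= tail x.
Proof.
have [x0 x00 tail_x0] := tail_regular.
have tx0 : 0 < tail x0.
  have /andP[+ _] := tail_x0 x0 (lexx _); apply: lt_le_trans.
  by rewrite mulr_gt0 ?powR_gt0// divr_gt0.
pose c' := Num.min 1 (Num.min (c / 2) (tail x0)).
have c'1 : c' <= 1 by rewrite ge_min lexx.
have c'c : c' <= c / 2 by rewrite !ge_min lexx orbT.
have c't : c' <= tail x0 by rewrite !ge_min lexx !orbT.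
have c'0 : 0 < c' by rewrite !lt_min ltr01 tx0 divr_gt0.
exists c'; first by rewrite c'0.
move=> x x1; have [x0x|xx0] := leP x0 x.
  have /andP[+ _] := tail_x0 x x0x; apply: le_trans.
  by rewrite ler_wpM2r// powR_ge0.
apply: (@le_trans _ _ (tail x0)); last by apply: tail_nonincreasing; exact: ltW.
apply: le_trans c't; rewrite ler_piMr//; first exact: ltW.
rewrite powR_expR; last by lra.
by rewrite -[leRHS]expR0 ler_expR mulNr oppr_le0 mulr_ge0 ?ln_ge0// ltW.
Qed.

Lemma sum_tail_powR_le (b : R) : 0 < b -> 1 < alpha * b ->
  exists C, forall m, \sum_(j < m) tail (j%:R - 2) `^ b <= C.
Proof.
move=> b0 ab1; have [x0 x00 tail_x0] := tail_regular.
apply: (@sum_powR_tail_le _ tail (2 * c) alpha x0) => //.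
- by move=> x; exact: tail01.
- by rewrite mulr_gt0.
- by move=> x /tail_x0/andP[].
Qed.

Lemma drift_bounds (rho : R) : 1 / 2 <= rho < 1 ->
  [/\ expR (- ln (1 / (1 - rho))) = 1 - rho, expR (ln (1 / (1 - rho))) = (1 - rho)^-1,
    1 - rho <= (1 - rho) / rho, (1 - rho) / rho <= 1 & (1 - rho) / rho <= 2 * (1 - rho)].
Proof.
move=> /andP[rho_ge rho_lt]; have rho0 : 0 < rho by lra.
have r0 : 0 < 1 - rho by lra.
have eK : expR (ln (1 / (1 - rho))) = (1 - rho)^-1.
  by rewrite lnK ?div1r// posrE invr_gt0.
split => //; first by rewrite expRN eK invrK.
- by rewrite ler_pdivlMr// ler_piMr//; lra.
- by rewrite ler_pdivrMr//; lra.
- by rewrite ler_pdivrMr//; nra.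
Qed.

Lemma eventually_good_upper (eta ep : R) : 0 < eta -> 0 < ep ->
  exists K0, forall rho : R, 1 / 2 <= rho < 1 -> let K := ln (1 / (1 - rho)) in
    K0 <= K -> exists y z, [/\ 0 <= z + y + 3,
      z + y + 3 <= (alpha^-1 + eta) * (K / ln K) &
      forall n : nat, exists D, [/\ measurable D, pr P D <= ep &
        forall w, ~ D w -> [/\ 0 <= U w <= 1, early_bound xi n z w &
          forall k : nat, (k <= n)%N ->
            late_bound xi k (y + (1 - rho) / rho * (n - k)%:R) w]]].
Proof.
have alpha1 := alpha_gt1; move=> eta0 ep0; have eta40 : 0 < eta / 4 by lra.
have alphaV0 : 0 < alpha^-1 by rewrite invr_gt0.
have [a [b [a1 b0 b1 ab1 [ab_lt as1]]]] := upper_exponents alpha_gt1 eta40.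
have [C le_C] := sum_tail_powR_le b0 ab1.
have [mu le_mu] := sum_pr_early_event_le xi_ident xi_neg_mean.
have [K1 K1P] := upper_error_small C mu alpha_gt1 eta40 ep0 a1 b0 ab_lt as1.
(* Then the constant [3] is at most [eta / 2 * x]; the other half of [eta * x] is shared between [y]
   and [z]. *)
have [K2 K2P] := @div_ln_large R (6 / eta).
exists (Num.max K1 K2) => rho rho12 K; rewrite ge_max => /andP[K1K K2K].
have [expNK _ r_ge _ _] := drift_bounds rho12; rewrite -/K in expNK.
have [ln1 _ + K0] := K2P K K2K.
set x := K / ln K; rewrite ler_pdivrMr// => x_ge.
have x0 : 0 < x by rewrite divr_gt0//; lra.
exists ((alpha^-1 + eta / 4) * x), (eta / 4 * x); split.
- by rewrite !addr_ge0// mulr_ge0//; lra.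
- by lra.
move=> n.
have r0 : 0 < (1 - rho) / rho by move: rho12 r_ge => /andP[]; lra.
have th0 : 0 < a * ln K by rewrite mulr_gt0//; lra.
have z0 : 0 < eta / 4 * x by rewrite mulr_gt0.
have [D [mD le_D goodD]] := good_event_upper xi_indep xi_ident U_unif n
  ((alpha^-1 + eta / 4) * x) r0 th0 z0 b0 b1 le_C le_mu.
exists D; split => //; apply: (le_trans le_D).
by apply: K1P => //; rewrite expNK.
Qed.

Lemma eventually_workload_le (eta ep : R) : 0 < eta -> 0 < ep ->
  exists K0, forall rho : R, 1 / 2 <= rho < 1 -> let K := ln (1 / (1 - rho)) in
    K0 <= K -> forall n : nat, exists D, [/\ measurable D, pr P D <= ep &
      forall w, ~ D w -> workload xi U rho n%:R w <= (alpha^-1 + eta) * (K / ln K)].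
Proof.
move=> eta0 ep0; have [K0 K0P] := eventually_good_upper eta0 ep0.
exists K0 => rho rho12 K K0K n.
have [y [z [zy0 zy_le /(_ n)[D [mD le_D goodD]]]]] := K0P rho rho12 K0K.
exists D; split => // w /goodD[U01 early_w late_w].
have [_ _ r_ge r_le _] := drift_bounds rho12.
have r01 : 0 <= (1 - rho) / rho <= 1.
  by rewrite r_le andbT (le_trans _ r_ge)//; move: rho12 => /andP[]; lra.
exact: le_trans (workload_le U01 r01 zy0 early_w late_w) zy_le.
Qed.

Lemma eventually_workload_ge (eta ep : R) : 0 < eta -> eta < alpha^-1 -> 0 < ep ->
  exists K0, forall rho : R, 1 / 2 <= rho < 1 -> let K := ln (1 / (1 - rho)) in
    K0 <= K -> exists N, forall n : nat, (N <= n)%N ->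
      exists D, [/\ measurable D, pr P D <= ep &
      forall w, ~ D w -> (alpha^-1 - eta) * (K / ln K) <= workload xi U rho n%:R w].
Proof.
have alpha1 := alpha_gt1; move=> eta0 eta_lt ep0; have ep20 : 0 < ep / 2 by lra.
have alphaV0 : 0 < alpha^-1 by rewrite invr_gt0.
(* The level is irrelevant here: this event gives [0 <= U w <= 1] and a finite supremum, hence
   [eta = 1]. *)
have [K1 K1P] := eventually_good_upper ltr01 ep20.
have [mu le_mu] := sum_pr_early_event_le xi_ident xi_neg_mean.
have [nu le_nu] : exists nu, forall m, \sum_(j < m) tail (j%:R - 2) <= nu.
  have [|nu le_nu] := sum_tail_powR_le (@ltr01 R); first by rewrite mulr1.
  exists nu => m; apply: le_trans (le_nu m); apply: ler_sum => j _.
  by rewrite powRr1//; have /andP[] := tail01 xi (j%:R - 2).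
have [c' /andP[c'0 c'1] tail_ge] := tail_ge_powR.
have lam0 : 0 <= - ln c' by rewrite oppr_ge0 ln_le0.
have [K2 K2P] := lower_error_small mu nu alpha_gt1 eta0 eta_lt lam0 ep20.
have [K3 K3P] := @div_ln_large R 1.
exists (Num.max K1 (Num.max K2 K3)) => rho rho12 K.
rewrite !ge_max => /and3P[K1K K2K K3K].
have [expNK expK r_ge r_le r_le2] := drift_bounds rho12; rewrite -/K in expNK expK.
have [ln1 _ _ K0] := K3P K K3K.
have := K2P K K2K => /=.
set x := K / ln K; set m := Num.truncn (_ * x); set B := Num.truncn (_ * expR K).
move=> [B0 mK x0 x_large le_err].
have [y [z [_ _ goodU]]] := K1P rho rho12 K1K.
exists (m * B)%N => n mBn.
have [D1 [mD1 le_D1 good1]] := goodU n.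
pose q := \prod_(j < m) tail j.+1%:R.
have q_ge : expR (- (m%:R * (- ln c' + alpha * ln K))) <= q.
  have -> : expR (- (m%:R * (- ln c' + alpha * ln K))) =
      \prod_(j < m) expR (ln c' - alpha * ln K).
    rewrite prodr_const card_ord -expRM_natr; congr expR; ring.
  (* All thresholds [j.+1] are at most [m <= K], so each factor is at least [c'] times the power
     [- alpha] of [K]. *)
  apply: ler_prod => j _; rewrite expR_ge0/=.
  apply: le_trans (tail_ge _ _); last by rewrite ler1n.
  rewrite expRD lnK ?posrE// ler_pM2l// powR_expR ?ltr0n// ler_expR mulNr lerN2.
  rewrite ler_pM2l// ler_ln ?posrE ?ltr0n//.
  by apply: le_trans mK; rewrite ler_nat; exact: ltn_ord.
have q0 : 0 < q by exact: lt_le_trans (expR_gt0 _) q_ge.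
have s0 : 0 < eta / 16 * x by rewrite mulr_gt0// divr_gt0.
have [D2 [mD2 le_D2 good2]] := good_event_lower xi_indep xi_ident mBn B0 s0 s0 q0 le_mu le_nu.
exists (D1 `|` D2); split; first exact: measurableU.
  apply: (le_trans (pr_setU _ _ _)) => //.
  by have := le_err q q_ge; lra.
move=> w /not_orP[/good1[U01 early_w late_w] /good2[late_n [b bB [early_b late_b]]]].
have r0 : 0 <= (1 - rho) / rho by rewrite (le_trans _ r_ge)//; move: rho12 => /andP[]; lra.
have mbB : (m * b <= m * B)%N by rewrite leq_mul2l (ltnW bB) orbT.
have mbn : (m * b <= n)%N by exact: leq_trans mBn.
have r01 : 0 <= (1 - rho) / rho <= 1 by rewrite r0.
apply: le_trans (workload_ge U01 r01 early_w late_w (leq_subr _ _) early_b late_n late_b).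
rewrite subKn//; apply: (lower_main_term (E := expR K)) => //.
- exact: expR_gt0.
- rewrite expK; apply: (le_trans (ler_wpM2r _ r_le2)).
    by rewrite -expK expR_ge0.
  by rewrite -mulrA mulfV ?mulr1// -expNK gt_eqF ?expR_gt0.
- exact: ltnW.
Qed.

End eventual_bounds.

Theorem theorem6 (R : realType)
  (d : measure_display) (T : measurableType d) (P : probability T R)
  (xi : int -> {RV P >-> R}) (U : {RV P >-> R})
  (xi_indep : mutually_independent xi)
  (xi_ident : identically_distributed xi)
  (U_unif : uniform01 U)
  (U_xi_indep : independent_of_family U xi)
  (xi_neg_mean : ('E_P[(fun w => Num.max (- xi 0 w) 0)%R] < +oo)%E)
  (c alpha : R) (c_gt0 : 0 < c) (alpha_gt1 : 1 < alpha)
  (xi_tail : fine (ccdf (xi 0) x) / (c * x `^ (- alpha)) @[x --> +oo] --> (1 : R))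
  (d' : R -> measure_display) (T' : forall rho : R, measurableType (d' rho))
  (Q : forall rho : R, probability (T' rho) R)
  (Winf : forall rho : R, {RV (Q rho) >-> R})
  (Winf_lim : forall rho : R, 0 < rho < 1 ->
     cvg_in_distribution (+oo : set_system R) (fun _ : R => P)
       (fun t : R => workload xi U rho t) (Q rho) (Winf rho)) :
  cvg_in_distribution (1^'- : set_system R) Q
    (fun (rho : R) (w : T' rho) =>
       ln (ln (1 / (1 - rho))) / ln (1 / (1 - rho)) * Winf rho w)
    P (cst (1 / alpha)).
Proof.
pose K rho : R := ln (1 / (1 - rho)).
have alphaV0 : 0 < alpha^-1 by rewrite invr_gt0; lra.
have K_large A : \forall rho \near 1^'-, A <= K rho.
  have lt1 : 1 - expR (- A) < 1 :> R by rewrite gtrDl oppr_lt0 expR_gt0.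
  near=> rho.
  have rho_lt : rho < 1 by near: rho; exact: nbhs_left_lt.
  have rho_gt : 1 - expR (- A) < rho by near: rho; exact: nbhs_left_gt.
  rewrite /K div1r -[leLHS]expRK ler_ln ?posrE ?expR_gt0 ?invr_gt0 ?subr_gt0//.
  rewrite -[leLHS]invrK -expRN lef_pV2 ?posrE ?expR_gt0 ?subr_gt0//.
  by rewrite lerBlDr addrC -lerBlDr ltW.
rewrite div1r; apply: cvg_in_distribution_cst => [rho|eta ep eta0 ep0].
  by apply: measurable_funM => //; exact: measurable_funP.
(* The lower bound on the workload asks for a margin below [alpha^-1]. *)
pose eta' := Num.min eta (alpha^-1 / 2).
have eta'_le : eta' <= eta by rewrite ge_min lexx.
have eta'_lt : eta' < alpha^-1 by rewrite gt_min; apply/orP; right; lra.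
have eta'0 : 0 < eta' by rewrite lt_min eta0/= divr_gt0.
have eta'20 : 0 < eta' / 2 by lra.
have eta'2_lt : eta' / 2 < alpha^-1 by lra.
have ep20 : 0 < ep / 2 by lra.
have [K1 K1P] := eventually_workload_le xi_indep xi_ident U_unif xi_neg_mean
  c_gt0 alpha_gt1 xi_tail eta'20 ep20.
have [K2 K2P] := eventually_workload_ge xi_indep xi_ident U_unif xi_neg_mean
  c_gt0 alpha_gt1 xi_tail eta'20 eta'2_lt ep20.
(* Then the [1] lost to the ramp is at most [eta' / 2 * x], the half of the margin left over by the
   workload bounds. *)
have [K3 K3P] := div_ln_large (2 / eta').
near=> rho.
have rho_lt : rho < 1 by near: rho; exact: nbhs_left_lt.
have rho_ge : 1 / 2 <= rho by near: rho; apply: nbhs_left_ge; lra.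
have rho12 : 1 / 2 <= rho < 1 by rewrite rho_ge.
have K1K : K1 <= K rho by near: rho; exact: K_large.
have K2K : K2 <= K rho by near: rho; exact: K_large.
have K3K : K3 <= K rho by near: rho; exact: K_large.
have [ln1 _ + K0] := K3P _ K3K; set x := K rho / ln (K rho) => x_ge.
have {}x_ge : 1 <= eta' / 2 * x by move: x_ge; rewrite ler_pdivrMr//; lra.
have x0 : 0 < x by rewrite divr_gt0//; lra.
have rho01 : 0 < rho < 1 by rewrite rho_lt andbT; lra.
have upper := limit_upper_tail (Winf_lim rho rho01) (K1P rho rho12 K1K).
have [N NP] := K2P rho rho12 K2K.
have lower := limit_lower_tail (Winf_lim rho rho01) NP.
move: upper lower; rewrite -/(K rho) -/x.
set Du := [set w | _ + 1 <= _]; set Dl := [set w | _ <= _ - 1] => upper lower.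
have mDu : measurable Du.
  have := measurable_preim (Winf rho) (measurable_itv `[(alpha^-1 + eta' / 2) * x + 1, +oo[).
  set S := (X in measurable X -> _); suff -> : Du = S by [].
  by rewrite /S; apply/seteqP; split => w /=; rewrite in_itv/= andbT.
have mDl : measurable Dl.
  have := measurable_preim (Winf rho) (measurable_itv `]-oo, (alpha^-1 - eta' / 2) * x - 1]).
  set S := (X in measurable X -> _); suff -> : Dl = S by [].
  by rewrite /S; apply/seteqP; split => w /=; rewrite in_itv.
exists (Du `|` Dl); split; first exact: measurableU.
  by apply: (le_trans (pr_setU _ mDu mDl)); lra.
move=> w /not_orP[/negP nu /negP nl]; rewrite -!ltNge in nu nl.
have -> : ln (K rho) / K rho = x^-1 by rewrite invf_div.
have eta_x : eta' * x <= eta * x by rewrite ler_pM2r.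
rewrite mulrC ler_distl ler_pdivlMr// ler_pdivrMr// !mulrDl mulNr.
clear - nu nl x_ge eta_x; lra.
Unshelve. all: by end_near. Qed.
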